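(* The HashGraph Protocol is live: in an execution of the HashGraph Protocol with $n$ parties of which at most $t<n/3$ are corrupted, every transaction placed in an honest party's buffer is eventually included in every honest party's log.
   Context: **Model.** There are $n$ parties. A static adversary chooses at the beginning of the execution at most $t<n/3$ parties to corrupt; corrupted parties are coordinated and may act arbitrarily, and the others are honest and follow the protocol exactly. The network is asynchronous: message delays are unbounded and the adversary may delay and reorder messages arbitrarily, but every message is eventually delivered. There is a public key infrastructure with an unforgeable signature scheme (the adversary cannot make a message appear to have been sent by an honest party), and all parties agree on a collision-resistant hash function. Each party receives transactions from an external mechanism (into its buffer) and outputs to a write-once log of transactions. **Events and hashgraphs.** The messages sent in the protocol are called events. An event contains a set of transactions its creator wants to commit to the log, a creator ID, a timestamp from the creator's local clock, a signature by the creator, and hashes of two other events, which act as parent pointers: its self-parent (for an honest creator, the creator's previous event) and its other-parent (for an honest creator, an earlier event created by a different party). The exception is each party's first (genesis) event, which has no parents. An ancestor of $x$ is any event that can be reached by traversing parent pointers in the subgraph rooted at $x$ ($x$ counts as an ancestor of itself); a self-ancestor is one reachable using self-parent pointers only; $x$ is a descendant of $y$ if $y$ is an ancestor of $x$. A hashgraph is a directed acyclic graph, kept locally by a party, whose vertices are the events its owner has created or has validated upon receipt and whose edges are the parent pointers; an honest party adds an event to its hashgraph only once it has all of that event's ancestors. A fork is a pair of events $(x,y)$ by the same creator, neither an ancestor of the other; honest parties never fork. An event $x$ observes a fork $(z,z')$ if $x$ is a descendant of both $z$ and $z'$. In a hashgraph $H$, $x$ sees $y$ if $y$ is an ancestor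 of $x$ in $H$ and $x$ does not observe a fork by $y$'s creator; $x$ strongly sees $y$ in $H$ if $x$ sees a set of more than $2n/3$ events with distinct creators each of which sees $y$. **Protocol.** Each party creates and multicasts a genesis event and then forever syncs its hashgraph with randomly chosen parties; in a sync between honest parties the sender shares all events it has. A received event is buffered until all its ancestors are in the receiver's hashgraph and is then added; incorrectly formatted events are discarded. In response to a sync, even one delivering several events, the receiver creates a single new event whose self-parent is its own previous event and whose other-parent is the latest event shared in the sync, and then runs on its hashgraph the following three procedures. *divideRounds.* Genesis events get round 1. For any other event $x$ let $r$ be the maximum of its parents' rounds; $x.round=r+1$ if $x$ strongly sees more than $2n/3$ round-$r$ witnesses from distinct parties, and $x.round=r$ otherwise. An event is a witness if it has no self-parent or its self-parent has a smaller round. *decideFame* (with a parameter $c$ setting how frequently coin rounds occur). For each witness $x$, process the witnesses $y$ with $y.round>x.round$ from earlier rounds to later. Let $d=y.round-x.round$. If $d=1$, $y$ votes ''yes'' if $y$ sees $x$ and ''no'' otherwise. If $d\ge 2$, let $s$ be the set of witnesses of round $y.round-1$ that $y$ strongly sees, $v$ the majority of their votes on $x$ (''yes'' on a tie), and $m$ the number of votes for $v$ in $s$. If $d \bmod c>0$ (normal round), $y$ votes $v$, and if in addition $m>2n/3$ then $x$'s fame is decided to be $v$ and the election for $x$ stops. If $d\bmod c=0$ (coin round), $y$ votes $v$ if $m>2n/3$, and otherwise votes by ''coin flip'', namely according to the middle bit of its signature (1 = ''yes'', 0 = ''no''); no decision is made in a coin round. If no decision is reached, $x$'s fame is undecided,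 and the party tries again once it has received a new event. A witness decided ''yes'' is famous; a famous witness is unique if it is the only famous witness produced by its creator in that round. *findOrder.* $x.roundReceived$ is the first round $R$ in which all unique famous witnesses see $x$ and the fame of all witnesses in all rounds $\le R$ has been decided. For $R=x.roundReceived$, let $S$ be the set of events $z$ such that $z$ is a self-ancestor of a round-$R$ unique famous witness and $x$ is an ancestor of $z$ but not of the self-parent of $z$; the logical timestamp of $x$ is the median of the timestamps of the events in $S$. The whitened signature of $x$ is the XOR of $x$'s signature with the signatures of all round-$R$ unique famous witnesses. All not-yet-committed events whose roundReceived is assigned are committed to the log, sorted by roundReceived, then logical timestamp, then whitened signature. *)

(* Defs.v *)
From HB Require Import structures.
From mathcomp Require Import all_boot all_order all_algebra.
From mathcomp Require Import all_classical all_reals all_analysis.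

Set Implicit Arguments.
Unset Strict Implicit.
Unset Printing Implicit Defensive.

(* An event names its parents by collision-resistant hashes, so an event
   determines its parents, and recursively all its ancestors.  The hash pointers
   are therefore represented by the parent events themselves: an event is the
   tree of everything below it, and the ancestor graph is acyclic.  Holding an
   event does not mean holding its ancestors; see [receive] below.  Parties are
   elements of 'I_n, signatures are ell-bit strings. *)

Record body (Tx : eqType) (n ell : nat) := Body {
  author : 'I_n;
  payload : seq Tx;
  stamp : nat;
  signature : ell.-tuple bool }.

Inductive event (Tx : eqType) (n ell : nat) :=
| Genesis of body Tx n ell
| Child of body Tx n ell & event Tx n ell & event Tx n ell.
(* [Child b sp op]: [sp] is the self-parent, [op] the other-parent. *)

Section EventEqType.
Context (Tx : eqType) (n ell : nat).

Let body_code (b : body Tx n ell) :=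
  (author b, payload b, stamp b, signature b).
Let body_decode (p : 'I_n * seq Tx * nat * ell.-tuple bool) :=
  let: (a, txs, ts, s) := p in Body a txs ts s.
Let body_codeK : cancel body_code body_decode. Proof. by case. Qed.
HB.instance Definition _ :=
  Equality.copy (body Tx n ell) (can_type body_codeK).

Fixpoint event_code (x : event Tx n ell) : GenTree.tree (body Tx n ell) :=
  match x with
  | Genesis b => GenTree.Leaf b
  | Child b sp op =>
      GenTree.Node 0 [:: GenTree.Leaf b; event_code sp; event_code op]
  end.
Fixpoint event_decode (g : GenTree.tree (body Tx n ell)) :
    option (event Tx n ell) :=
  match g with
  | GenTree.Leaf b => Some (Genesis b)
  | GenTree.Node _ [:: GenTree.Leaf b; g1; g2] =>
      if (event_decode g1, event_decode g2) is (Some sp, Some op)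
      then Some (Child b sp op) else None
  | _ => None
  end.
Let event_codeK : pcancel event_code event_decode.
Proof. by elim=> //= b sp -> op ->. Qed.
HB.instance Definition _ :=
  Equality.copy (event Tx n ell) (pcan_type event_codeK).

End EventEqType.

Section Hashgraph.
Context (Tx : eqType) (n ell : nat).
Local Notation event := (event Tx n ell).
Implicit Types (x y z w : event) (H : seq event).

Definition body_of x := match x with Genesis b => b | Child b _ _ => b end.
Definition creator x := author (body_of x).
Definition txs x := payload (body_of x).
Definition self_parent x : option event :=
  match x with Genesis _ => None | Child _ sp _ => Some sp end.

Fixpoint ancestors x : seq event :=
  x :: match x with
       | Genesis _ => [::]
       | Child _ sp op => ancestors sp ++ ancestors op
       end.
Fixpoint self_ancestors x : seq event :=
  x :: match x with
       | Genesis _ => [::]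
       | Child _ sp _ => self_ancestors sp
       end.

(* What a receiver can check about the prescribed format: the self-parent is the
   previous event of the same creator, i.e. no event of that creator visible
   through the other-parent is strictly later than the self-parent; and the
   other-parent is by another party.  (Two incomparable events of a creator, a
   fork, are not a format error.) *)
Definition well_formed x : bool :=
  match x with
  | Genesis _ => true
  | Child b sp op =>
      [&& creator sp == author b,
          creator op != author b &
          ~~ has (fun z => [&& creator z == author b, z != sp
                             & sp \in ancestors z]) (ancestors op)]
  end.

Definition is_fork y z : bool :=
  [&& creator y == creator z, y \notin ancestors z & z \notin ancestors y].

Definition observes_fork_by x (a : 'I_n) : bool :=
  has (fun y => has (fun z => (creator y == a) && is_fork y z) (ancestors x))
      (ancestors x).

(* The hashgraph of an honest party is closed under ancestors, so that the
   relations below do not depend on the hashgraph in which they are taken. *)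
Definition sees x y : bool :=
  (y \in ancestors x) && ~~ observes_fork_by x (creator y).

Definition supermajority (m : nat) : bool := 2 * n < 3 * m.

Definition creators (s : seq event) : {set 'I_n} := [set a in map creator s].

Definition strongly_sees x y : bool :=
  supermajority #|creators [seq z <- ancestors x | sees x z && sees z y]|.

(* The round of [x], and the witnesses among the ancestors of [x] (including
   [x]), each with its round; see [roundE]. *)
Fixpoint divide_rounds x : nat * seq (nat * event) :=
  match x with
  | Genesis _ => (1, [:: (1, x)])
  | Child _ sp op =>
      let: (rsp, wsp) := divide_rounds sp in
      let: (rop, wop) := divide_rounds op in
      let r := maxn rsp rop in
      let s := [seq p.2 | p <- wsp ++ wop & (p.1 == r) && strongly_sees x p.2] in
      let rx := if supermajority #|creators s| then r.+1 else r in
      (rx, if rsp < rx then (rx, x) :: wsp ++ wop else wsp ++ wop)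
  end.

Definition round x : nat := (divide_rounds x).1.

Definition witness x : bool :=
  if self_parent x is Some sp then round sp < round x else true.

Lemma divide_roundsE x p :
  (p \in (divide_rounds x).2) =
  [&& p.2 \in ancestors x, witness p.2 & p.1 == round p.2].
Proof.
have roundG b : round (Genesis b) = 1 by [].
elim: x p => [b|b sp IHsp op IHop] [r w].
  rewrite /= !inE xpair_eqE; case: (w =P Genesis b) => [->|]; last first.
    by rewrite andbF.
  by rewrite andbT /witness /= roundG.
rewrite /= in_cons mem_cat.
set x := Child b sp op.
have -> : (divide_rounds x).2 =
   (if round sp < round x then (round x, x) :: (divide_rounds sp).2 ++
      (divide_rounds op).2 else (divide_rounds sp).2 ++ (divide_rounds op).2).
  rewrite /round /x /=; case: (divide_rounds sp) => rsp wsp.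
  by case: (divide_rounds op) => rop wop.
have E : ((r, w) \in (divide_rounds sp).2 ++ (divide_rounds op).2) =
  [&& (w \in ancestors sp) || (w \in ancestors op), witness w & r == round w].
  by rewrite mem_cat IHsp IHop /= andb_orl.
have wx : witness x = (round sp < round x) by [].
case: ifP => h; rewrite ?in_cons E.
  rewrite xpair_eqE; case: (w =P x) => [->|_] /=.
    by rewrite andbT wx h /=; case: (r == round x); rewrite ?andbF.
  by rewrite andbF.
by case: (w =P x) => [->|//]; rewrite wx h /= andbF.
Qed.

Lemma roundE b sp op (x := Child b sp op) (r := maxn (round sp) (round op)) :
  round x =
  if supermajority #|creators
       [seq w <- ancestors sp ++ ancestors op |
         [&& witness w, round w == r & strongly_sees x w]]|
  then r.+1 else r.
Proof.
have -> : round x =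
  if supermajority #|creators [seq p.2 | p <- (divide_rounds sp).2 ++
     (divide_rounds op).2 & (p.1 == r) && strongly_sees x p.2]|
  then r.+1 else r.
  rewrite /x /r /round [divide_rounds (Child b sp op)]/=.
  case: (divide_rounds sp) => rsp wsp.
  by case: (divide_rounds op) => rop wop.
set s := [seq p.2 | p <- _ & _]; set s' := [seq w <- _ | _].
suff ss' : s =i s'.
  suff -> : creators s = creators s' by [].
  by apply/finset.setP => a; rewrite !inE; apply: eq_mem_map.
move=> w; rewrite mem_filter; apply/mapP/idP => [[[q v]]|].
  rewrite mem_filter /= => /andP[/andP[/eqP -> ss]].
  rewrite !mem_cat !divide_roundsE /= => mw ->; move: mw; rewrite ss.
  by case/orP => /and3P[-> -> /eqP <-]; rewrite eqxx ?orbT.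
case/andP => /and3P[ww /eqP rw ss] mw; exists (r, w) => //.
rewrite mem_filter eqxx ss /= mem_cat !divide_roundsE /= ww rw eqxx !andbT.
by rewrite -mem_cat.
Qed.

Definition middle_bit (s : ell.-tuple bool) : bool := nth false s ell./2.

(* Majority vote (true, i.e. "yes", on a tie) and number of votes for it. *)
Definition tally_of (vote : event -> bool) (s : seq event) : bool * nat :=
  let yes := count vote s in
  let no := count (predC vote) s in
  if no <= yes then (true, yes) else (false, no).

Definition electors y : seq event :=
  [seq w <- undup (ancestors y)
  | [&& witness w, (round w).+1 == round y & strongly_sees y w]].

Context (c : nat). (* frequency of the coin rounds *)

(* Vote on [x] of a witness [y] with [round y - round x = d > 0]. *)
Fixpoint vote (d : nat) x y : bool :=
  if d is d'.+1 then
    if d' == 0 then sees y x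
    else let: (v, m) := tally_of (vote d' x) (electors y) in
         if (d %% c == 0) && ~~ supermajority m
         then middle_bit (signature (body_of y)) else v
  else false.

Definition count_votes x y : bool * nat :=
  tally_of (vote (round y - round x).-1 x) (electors y).

Definition decides x y : bool :=
  let d := round y - round x in
  [&& 1 < d, 0 < d %% c & supermajority (count_votes x y).2].

(* The result of the election for [x] in the hashgraph [H] ([None] as long as
   it is undecided): the verdict of the first deciding witness. *)
Definition fame H x : option bool :=
  let voters := sort (fun y y' => round y <= round y')
                     [seq y <- H | witness y && (round x < round y)] in
  ohead [seq (count_votes x y).1 | y <- voters & decides x y].

Definition famous H r x : bool :=
  [&& x \in H, witness x, round x == r & fame H x == Some true].

Definition unique_famous H r : seq event :=
  [seq x <- H | famous H r x &&
     all (fun y => famous H r y && (creator y == creator x) ==> (y == x)) H].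

(* The witnesses of the last round of [H] are never decided in [H], so only
   rounds up to the last one are of interest. *)
Definition round_received H x : option nat :=
  ohead [seq r <- iota 1 (\max_(y <- H) round y) |
    all (fun w => sees w x) (unique_famous H r) &&
    all (fun w => witness w && (round w <= r) ==> isSome (fame H w)) H].

(* The upper median of a sequence of even length. *)
Definition median (s : seq nat) : nat := nth 0 (sort leq s) (size s)./2.

Definition logical_timestamp H (r : nat) x : nat :=
  median [seq stamp (body_of z) |
    z <- H & [&& has (fun w => z \in self_ancestors w) (unique_famous H r),
                 x \in ancestors z
               & ~~ (if self_parent z is Some sp then x \in ancestors sp
                     else false)]].

Definition xor_sig (s s' : ell.-tuple bool) : ell.-tuple bool :=
  [tuple tnth s i (+) tnth s' i | i < ell].

Definition whitened_signature H (r : nat) x : ell.-tuple bool :=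
  foldr xor_sig (signature (body_of x))
        [seq signature (body_of w) | w <- unique_famous H r].

Definition bits_value (s : seq bool) : nat := foldl (fun m (b : bool) => m.*2 + b) 0 s.

Definition commit_le H x y : bool :=
  let key z := let r := odflt 0 (round_received H z) in
    (r, logical_timestamp H r z, bits_value (whitened_signature H r z)) in
  let: (r, t, s) := key x in
  let: (r', t', s') := key y in
  (r < r') || (r == r') && ((t < t') || (t == t') && (s <= s')).

Definition newly_ordered H (committed : seq event) : seq event :=
  sort (commit_le H)
    [seq x <- H | (x \notin committed) && isSome (round_received H x)].

Record local := Local {
  hashgraph : seq event;
  waiting : seq event;        (* received, some ancestor still missing *)
  last_event : option event;  (* the latest event created by the owner *)
  buffer : seq Tx;
  committed : seq event }.

Definition tx_log (l : local) : seq Tx := flatten (map txs (committed l)).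

Definition run_procedures (l : local) : local :=
  Local (hashgraph l) (waiting l) (last_event l) (buffer l)
    (committed l ++ newly_ordered (hashgraph l) (committed l)).

Definition receive (es : seq event) (l : local) : local :=
  let pool := waiting l ++ [seq e <- es | well_formed e] in
  let ready e := all (fun y => y \in hashgraph l ++ pool) (ancestors e) in
  Local (hashgraph l ++
           [seq e <- undup pool | ready e & e \notin hashgraph l])
        [seq e <- pool | ~~ ready e] (last_event l) (buffer l) (committed l).

(* The latest event shared by a corrupted sender can fail to be a legitimate
   other-parent; then no event is created. *)
Definition create_child (p : 'I_n) (clock : nat) (s : ell.-tuple bool)
    (op : event) (l : local) : local :=
  if last_event l is Some sp then
    if (op \in hashgraph l) && (creator op != p) then
      let x := Child (Body p (buffer l) clock s) sp op in
      Local (rcons (hashgraph l) x) (waiting l) (Some x) [::] (committed l)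
    else l
  else l.

(* [latest] is the latest event shared in a sync; [None] marks the multicast of
   a genesis event, which is not a sync. *)
Record message := Message {
  dest : 'I_n;
  shared : seq event;
  latest : option event }.

Definition on_message (p : 'I_n) (m : message) (clock : nat)
    (s : ell.-tuple bool) (l : local) : local :=
  let l1 := receive (shared m) l in
  run_procedures
    (if latest m is Some op then create_child p clock s op l1 else l1).

(* All messages ever sent stay in [network]; a message is identified by its
   position there. *)
Record state := State {
  party : 'I_n -> local;
  network : seq message;
  delivered : seq nat }.

Definition initial : state :=
  State (fun=> Local [::] [::] None [::] [::]) [::] [::].

Definition set_party (p : 'I_n) (l : local) (f : 'I_n -> local) :=
  fun q => if q == p then l else f q.

(* One step of the asynchronous execution, chosen by the environment:
   - [Submit p tx]: a transaction is put into the buffer of [p];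
   - [Wake p clock]: [p] creates and multicasts its genesis event or, if it has
     done so already, initiates a sync;
   - [Deliver i clock]: message number [i] is delivered;
   - [Corrupt f m]: the corrupted party [f] sends [m].
   The clocks are the local clock readings of the acting party. *)
Inductive action :=
| Submit of 'I_n & Tx
| Wake of 'I_n & nat
| Deliver of nat & nat
| Corrupt of 'I_n & message.

Context (C : {set 'I_n}). (* the corrupted parties *)

(* Unforgeability of signatures. *)
Definition authentic (st : state) (e : event) : bool :=
  (creator e \in C) ||
  (if last_event (party st (creator e)) is Some y then e \in self_ancestors y
   else false).

(* [j] and [s] are the random choices of the honest party acting in this step:
   its sync partner [lift p j], and the signature of the event it creates. *)
Definition step (a : action) (j : 'I_n.-1) (s : ell.-tuple bool) (st : state) :
    state :=
  match a with
  | Submit p tx =>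
      let l := party st p in
      State (set_party p (Local (hashgraph l) (waiting l) (last_event l)
                                (rcons (buffer l) tx) (committed l)) (party st))
            (network st) (delivered st)
  | Wake p clock =>
      let l := party st p in
      if p \in C then st
      else if last_event l is Some y then
        State (party st)
          (rcons (network st) (Message (lift p j) (hashgraph l) (Some y)))
          (delivered st)
      else
        let g := Genesis (Body p (buffer l) clock s) in
        State (set_party p (Local (rcons (hashgraph l) g) (waiting l) (Some g)
                                  [::] (committed l)) (party st))
              (network st ++ [seq Message q [:: g] None
                             | q <- enum 'I_n & q != p])
              (delivered st)
  | Deliver i clock =>
      if onth (network st) i is Some m then
        let p := dest m in
        if [&& p \notin C, i \notin delivered st
             & isSome (last_event (party st p))] then
          State (set_party p (on_message p m clock s (party st p)) (party st))
                (network st) (rcons (delivered st) i)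
        else st
      else st
  | Corrupt f m =>
      if [&& f \in C, all (authentic st) (shared m)
           & (if latest m is Some e then e \in shared m else true)] then
        State (party st) (rcons (network st) m) (delivered st)
      else st
  end.

Fixpoint run (acts : nat -> action) (partner : nat -> 'I_n.-1)
    (sg : nat -> ell.-tuple bool) (k : nat) : state :=
  if k is k'.+1
  then step (acts k') (partner k') (sg k') (run acts partner sg k')
  else initial.

(* Honest parties keep syncing forever, and every message sent to an honest
   party is eventually delivered. *)
Definition fair (acts : nat -> action) (partner : nat -> 'I_n.-1)
    (sg : nat -> ell.-tuple bool) : Prop :=
  (forall p k, p \notin C -> exists k' clock, k <= k' /\ acts k' = Wake p clock)
  /\
  (forall k i m, onth (network (run acts partner sg k)) i = Some m ->
     dest m \notin C ->
     exists k', i \in delivered (run acts partner sg k')).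

End Hashgraph.

Section Randomness.
Local Open Scope classical_set_scope.
Local Open Scope ereal_scope.
Context (Tx : eqType) (n ell : nat).
Context (d : measure_display) (Omega : measurableType d) (R : realType).
Context (P : probability Omega R).
Context (acts : nat -> Omega -> action Tx n ell).
Context (partner : nat -> Omega -> 'I_n.-1).
Context (sg : nat -> Omega -> ell.-tuple bool).

(* Everything that happened before the random choices of step [k], including
   the environment's choice of step [k]. *)
Definition past (k : nat) (w : Omega) :
    seq (action Tx n ell) * seq ('I_n.-1 * ell.-tuple bool) :=
  (mkseq (fun i => acts i w) k.+1, mkseq (fun i => (partner i w, sg i w)) k).

(* Given the past, the sync partner is uniform among the n-1 other parties and
   the middle bit of the honest signature is an independent fair coin.  The
   environment, whose actions belong to the past, may be randomized and may
   use everything that has happened. *)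
Definition fresh_randomness : Prop :=
  forall (k : nat) (B : set (seq (action Tx n ell) *
                             seq ('I_n.-1 * ell.-tuple bool)))
         (j : 'I_n.-1) (b : bool),
    measurable [set w | B (past k w)] /\
    P [set w | [/\ B (past k w), partner k w = j & middle_bit (sg k w) = b]] =
      ((2 * n.-1)%:R^-1)%R%:E * P [set w | B (past k w)].

End Randomness.

(* Main.v *)
(* Syncs with random partners almost surely connect all honest parties infinitely
   often, so that honest events spread and rounds grow without bound.  Only
   finitely many creators ever show a fork to the honest parties; from some round
   on, every witness below an honest event therefore strongly sees a supermajority
   of the preceding round.  In a coin round of an election, only the majority found
   by the first honest witness can be backed by a supermajority; if the coins of all
   honest witnesses of the round agree with it, the votes are unanimous from the
   next round on and the election is decided.  Each coin is fair given the past, so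
   almost surely every election has such a coin round.  The same holds for the
   fictitious election of a witness that no voter sees; it has the outcome of the
   election of every witness of its round that arrives late.  An event of an honest
   party is below all witnesses of large rounds, hence is received as soon as the
   fame of all witnesses up to such a round is decided. *)
Require Import Defs.
From mathcomp Require Import all_boot all_order all_algebra.
From mathcomp Require Import all_classical all_reals all_analysis.
From mathcomp Require Import zify.

Set Implicit Arguments.
Unset Strict Implicit.
Unset Printing Implicit Defensive.

(** The scheduler is adaptive: it knows every coin flipped so far when it chooses which honest
    witness is created next, and the first one of a coin round fixes the value that the others have
    to hit. The coins of a round can therefore not be treated as one independent block. Instead,
    bets are placed on one coin at a time, at a moment when the target value and everything about
    the new witness except its signature are already settled. As every bet is won with the same
    positive conditional probability, infinitely many bets are almost surely won infinitely often.
    This single probabilistic fact serves both coins and sync partners; with [lucky] and [wakes] as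
    hypotheses, all the rest is a deterministic argument about one run. It has to be applied to
    countably many elections only, although there may be uncountably many events: elections are
    indexed by the time, the party and the position at which their candidate stands in a
    hashgraph. *)

Section Supermajorities.
Context (n : nat).
Implicit Types A B C : {set 'I_n}.

Lemma cardC3 C : 3 * #|C| < n -> supermajority n #|finset.setC C|.
Proof. by rewrite /supermajority => hC; have := cardsC C; rewrite card_ord; lia. Qed.

Lemma supermajority_leq m m' : m <= m' -> supermajority n m -> supermajority n m'.
Proof. by rewrite /supermajority; lia. Qed.

Lemma supermajorityS A B : A \subset B -> supermajority n #|A| -> supermajority n #|B|.
Proof. by move=> /subset_leq_card; apply: supermajority_leq. Qed.

Lemma card_setI_ge A B : #|A| + #|B| <= n + #|A :&: B|.
Proof.
rewrite -cardsUI leq_add2r -[leqRHS]card_ord -cardsT.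
exact/subset_leq_card/finset.subsetT.
Qed.

(** Two supermajorities overlap in more than [n / 3] parties, which is more than [C] has. *)
Lemma supermajorityI C A B : 3 * #|C| < n ->
  supermajority n #|A| -> supermajority n #|B| ->
  exists a, [/\ a \in A, a \in B & a \notin C].
Proof.
rewrite /supermajority => hC hA hB.
have hAB := card_setI_ge A B.
have /fintype.subsetPn [a] : ~~ (A :&: B \subset C).
  by apply/negP => /subset_leq_card; lia.
by rewrite !inE => /andP[aA aB] aC; exists a.
Qed.

Lemma supermajority_honest C A : 3 * #|C| < n -> supermajority n #|A| ->
  exists2 a, a \in A & a \notin C.
Proof. by move=> hC hA; have [a []] := supermajorityI hC hA hA; exists a. Qed.

End Supermajorities.

(** * Ancestors and rounds *)

Section EventGraph.
Context (Tx : eqType) (n ell : nat).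
Local Notation event := (event Tx n ell).
Implicit Types (x y z w u e sp op : event) (b : body Tx n ell) (a : 'I_n) (s : seq event).

Lemma mem_creators a s : (a \in creators s) = (a \in map (@creator Tx n ell) s).
Proof. by rewrite inE. Qed.

Lemma creatorsP a s : reflect (exists2 x, x \in s & creator x = a) (a \in creators s).
Proof.
rewrite mem_creators; apply: (iffP mapP) => [[x xs ->]|[x xs <-]]; by exists x.
Qed.

Lemma creatorsS s s' : {subset s <= s'} -> creators s \subset creators s'.
Proof.
move=> ss'; apply/fintype.subsetP => a /creatorsP[x /ss' xs <-].
by apply/creatorsP; exists x.
Qed.

Lemma eq_creators s s' : s =i s' -> creators s = creators s'.
Proof.
by move=> ss'; apply/eqP; rewrite finset.eqEsubset !creatorsS // => x; rewrite ss'.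
Qed.

Lemma anc_refl x : x \in ancestors x.
Proof. by case: x => *; rewrite /= inE eqxx. Qed.

Lemma mem_anc_child b sp op x :
  (x \in ancestors (Child b sp op)) =
  [|| x == Child b sp op, x \in ancestors sp | x \in ancestors op].
Proof. by rewrite /= inE mem_cat. Qed.

Lemma anc_trans y x z : x \in ancestors y -> y \in ancestors z -> x \in ancestors z.
Proof.
move=> xy; elim: z => [b|b sp IHs op IHo].
  by move: xy => /[swap]; rewrite /= inE => /eqP ->.
rewrite !mem_anc_child => /or3P[/eqP yz|/IHs ->|/IHo ->]; rewrite ?orbT //.
by move: xy; rewrite yz mem_anc_child.
Qed.

(** The length of [ancestors], repetitions included, is the measure that makes the parent relation
    acyclic. *)
Lemma anc_size x y : x \in ancestors y -> x = y \/ size (ancestors x) < size (ancestors y).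
Proof.
elim: y => [b|b sp IHs op IHo]; first by rewrite /= inE => /eqP ->; left.
rewrite mem_anc_child => /or3P[/eqP ->|/IHs h|/IHo h]; first by left.
  by right; rewrite /= size_cat; case: h => [->|]; lia.
by right; rewrite /= size_cat; case: h => [->|]; lia.
Qed.

Lemma anc_antisym x y : x \in ancestors y -> y \in ancestors x -> x = y.
Proof. by move=> /anc_size[//|h] /anc_size[//|]; lia. Qed.

Lemma child_notin_anc (b : body Tx n ell) sp op :
  (Child b sp op \notin ancestors sp) && (Child b sp op \notin ancestors op).
Proof.
have h y : Child b sp op \in ancestors y -> size (ancestors (Child b sp op)) <= size (ancestors y).
  by move=> /anc_size[->|/ltnW].
by apply/andP; split; apply/negP => /h; rewrite /= size_cat; lia.
Qed.

Lemma self_anc_refl x : x \in self_ancestors x.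
Proof. by case: x => *; rewrite /= inE eqxx. Qed.

Lemma mem_self_anc_child b sp op x :
  (x \in self_ancestors (Child b sp op)) =
  (x == Child b sp op) || (x \in self_ancestors sp).
Proof. by rewrite /= inE. Qed.

Lemma self_anc_anc x y : x \in self_ancestors y -> x \in ancestors y.
Proof.
elim: y => [b|b sp IHs op _]; first by rewrite /= !inE.
by rewrite mem_self_anc_child mem_anc_child => /orP[->//|/IHs ->]; rewrite orbT.
Qed.

Lemma self_anc_trans y x z :
  x \in self_ancestors y -> y \in self_ancestors z -> x \in self_ancestors z.
Proof.
move=> xy; elim: z => [b|b sp IHs op IHo].
  by move: xy => /[swap]; rewrite /= inE => /eqP ->.
rewrite !mem_self_anc_child => /orP[/eqP yz|/IHs ->]; rewrite ?orbT //.
by move: xy; rewrite yz mem_self_anc_child.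
Qed.

Lemma self_anc_total x y z :
  x \in self_ancestors z -> y \in self_ancestors z ->
  x \in self_ancestors y \/ y \in self_ancestors x.
Proof.
elim: z => [b|b sp IHs op IHo]; first by rewrite /= !inE => /eqP-> /eqP->; left; rewrite /= inE.
rewrite !mem_self_anc_child => /orP[/eqP->|hx] /orP[/eqP->|hy].
- by left; apply: self_anc_refl.
- by right; rewrite mem_self_anc_child hy orbT.
- by left; rewrite mem_self_anc_child hx orbT.
- exact: IHs.
Qed.

Lemma round_gt0 x : 0 < round x.
Proof.
elim: x => [b|b sp IHs op IHo] //; rewrite roundE; case: ifP => // _.
by rewrite leq_max IHs.
Qed.

Lemma round_sp b sp op : round sp <= round (Child b sp op).
Proof. by rewrite roundE; case: ifP => _; lia. Qed.

Lemma round_op b sp op : round op <= round (Child b sp op).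
Proof. by rewrite roundE; case: ifP => _; lia. Qed.

Lemma round_anc x y : x \in ancestors y -> round x <= round y.
Proof.
elim: y => [b|b sp IHs op IHo]; first by rewrite /= inE => /eqP->.
rewrite mem_anc_child => /or3P[/eqP->//|/IHs h|/IHo h]; apply: leq_trans h _.
  exact: round_sp.
exact: round_op.
Qed.

Lemma mem_electors y w : (w \in electors y) =
  [&& w \in ancestors y, witness w, (round w).+1 == round y & strongly_sees y w].
Proof. by rewrite mem_filter mem_undup andbC. Qed.

(** A witness need not satisfy this: its round may be inherited from its other-parent. *)
Definition promoted x : bool := supermajority n #|creators (electors x)|.

Lemma promoted_child b sp op : maxn (round sp) (round op) < round (Child b sp op) ->
  promoted (Child b sp op) /\ round (Child b sp op) = (maxn (round sp) (round op)).+1.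
Proof.
set x := Child b sp op; set r := maxn _ _ => hr.
move: (roundE b sp op) hr; rewrite -/x -/r => ->; case: ifP => [h _|_]; last by lia.
have rx : round x = r.+1 by rewrite roundE h.
split=> //; apply: supermajorityS h; apply: creatorsS => w.
rewrite mem_filter mem_electors mem_cat => /andP[/and3P[-> /eqP-> ->] h].
by rewrite rx eqxx /= /x mem_anc_child h orbT.
Qed.

(** Rounds rise by at most one per event. A lowest ancestor of round at least [r] has both parents
    below round [r], so it owes its round to a promotion; [1 < r] excludes genesis events. *)
Lemma promoted_ancestor x r : 1 < r -> r <= round x ->
  exists y, [/\ y \in ancestors x, round y = r, witness y & promoted y].
Proof.
move=> r1; elim: x => [b|b sp IHs op IHo] hr.
  by move: hr; rewrite (_ : round _ = 1) //; lia.
have anc y : y \in ancestors sp \/ y \in ancestors op -> y \in ancestors (Child b sp op).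
  by rewrite mem_anc_child => -[->|->]; rewrite ?orbT.
have [/IHs [y [ya *]]|h1] := leqP r (round sp).
  by exists y; split=> //; apply: anc; left.
have [/IHo [y [ya *]]|h2] := leqP r (round op).
  by exists y; split=> //; apply: anc; right.
have [px rx] := @promoted_child b sp op ltac:(lia).
exists (Child b sp op); split=> //; first exact: anc_refl.
  by lia.
by rewrite /witness /= ; lia.
Qed.

Lemma witness_below x : exists w, [/\ w \in self_ancestors x, witness w & round w = round x].
Proof.
elim: x => [b|b sp [w [ws ww rw]] op _]; first by exists (Genesis b); rewrite self_anc_refl.
have [h|h] := boolP (witness (Child b sp op)).
  by exists (Child b sp op); rewrite self_anc_refl.
exists w; split=> //; first by rewrite mem_self_anc_child ws orbT.
by move: h; have := round_sp b sp op; rewrite /witness /=; lia.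
Qed.

Lemma sees_anc x y : sees x y -> y \in ancestors x.
Proof. by case/andP. Qed.

Lemma observes_forkS x y a : x \in ancestors y ->
  observes_fork_by x a -> observes_fork_by y a.
Proof.
move=> xy /hasP[u ux /hasP[v vx h]]; apply/hasP; exists u; first exact: anc_trans xy.
by apply/hasP; exists v => //; apply: anc_trans xy.
Qed.

Lemma strongly_seesS x y w :
  x \in ancestors y ->
  (forall a, observes_fork_by y a -> observes_fork_by x a) ->
  strongly_sees x w -> strongly_sees y w.
Proof.
move=> xy hF; apply: supermajorityS; apply: creatorsS => u.
rewrite !mem_filter => /andP[/andP[/andP[_ uF] uw] ux].
rewrite uw (anc_trans ux xy) /sees (anc_trans ux xy) /= !andbT.
by apply: contra uF; apply: hF.
Qed.

(* Bets on a coin are placed before the event carrying it is signed, so what they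
   depend on must not change with the signature. *)
Section Signature.
Context (b b' : body Tx n ell) (sp op : event).
Context (bb' : author b = author b').
Let x := Child b sp op.
Let x' := Child b' sp op.
Let old := ancestors sp ++ ancestors op.

(** An event is comparable to all its ancestors, so it is never half of a fork that it observes
    itself. *)
Lemma observes_fork_child b0 a : observes_fork_by (Child b0 sp op) a =
  has (fun y => has (fun z => (creator y == a) && is_fork y z) old) old.
Proof.
apply/hasP/hasP => -[y yx /hasP[z zx /andP[ya yz]]].
  have yo : y \in old.
    move: yx; rewrite mem_anc_child -mem_cat => /orP[/eqP yx|//].
    by move: yz; rewrite /is_fork yx zx !andbF.
  have zo : z \in old.
    move: zx; rewrite mem_anc_child -mem_cat => /orP[/eqP zx|//].
    by move: yz; rewrite /is_fork zx yx !andbF.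
  by exists y => //; apply/hasP; exists z => //; apply/andP.
have h w : w \in old -> w \in ancestors (Child b0 sp op).
  by rewrite mem_anc_child -mem_cat => ->; rewrite orbT.
by exists y; [exact: h|apply/hasP; exists z; [exact: h|apply/andP]].
Qed.

Lemma sees_child b0 w : w \in old -> sees (Child b0 sp op) w =
  ~~ has (fun y => has (fun z => (creator y == creator w) && is_fork y z) old) old.
Proof. by rewrite /sees observes_fork_child mem_anc_child -mem_cat => ->; rewrite orbT. Qed.

Lemma strongly_sees_signature w : w \in old -> strongly_sees x w = strongly_sees x' w.
Proof.
move=> wo; rewrite /strongly_sees; congr (supermajority n #|pred_of_set _|).
(* The event may be one of its own intermediaries; it is then exchanged for its twin, which has the
   same creator. *)
have E : forall b0, author b0 = author b ->
   creators [seq z <- ancestors (Child b0 sp op) | sees (Child b0 sp op) z && sees z w]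
  = creators [seq z <- ancestors x | sees x z && sees z w].
  move=> b0 hb0; apply/finset.setP => a; apply/creatorsP/creatorsP => -[u];
  rewrite mem_filter mem_anc_child -mem_cat => /andP[/andP[h1 h2] h3] <-;
  move: h3 => /orP[/eqP u_eq|uo].
  - exists x; last by rewrite u_eq.
    move: h1 h2; rewrite mem_filter anc_refl u_eq => h1 h2.
    rewrite /sees !anc_refl !observes_fork_child /= andbT.
    move: h1 h2; rewrite /sees !observes_fork_child /creator /= hb0.
    by rewrite anc_refl /= => -> /andP[_ ->]; rewrite mem_anc_child -mem_cat wo orbT.
  - exists u => //; rewrite mem_filter h2 mem_anc_child -mem_cat uo orbT !andbT.
    by move: h1; rewrite !sees_child.
  - exists (Child b0 sp op); last by rewrite u_eq.
    move: h1 h2; rewrite mem_filter anc_refl u_eq => h1 h2.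
    rewrite /sees !anc_refl !observes_fork_child /= andbT.
    move: h1 h2; rewrite /sees !observes_fork_child /creator /= hb0.
    by rewrite anc_refl /= => -> /andP[_ ->]; rewrite mem_anc_child -mem_cat wo orbT.
  - exists u => //; rewrite mem_filter h2 mem_anc_child -mem_cat uo orbT !andbT.
    by move: h1; rewrite !sees_child.
by rewrite -(E b') // bb'.
Qed.

Lemma round_signature : round x = round x'.
Proof.
rewrite !roundE (eq_creators (s' := [seq w <- old |
  [&& witness w, round w == maxn (round sp) (round op) & strongly_sees x' w]])) //.
move=> w; rewrite !mem_filter; case wo: (w \in _); rewrite ?andbF //.
by rewrite strongly_sees_signature.
Qed.

Lemma witness_signature : witness x = witness x'.
Proof. by rewrite /witness /= round_signature. Qed.

Lemma electors_signature : electors x = electors x'.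
Proof.
have E b0 : electors (Child b0 sp op) = [seq w <- undup old |
    [&& witness w, (round w).+1 == round (Child b0 sp op) & strongly_sees (Child b0 sp op) w]].
  (* The event is not its own elector, as electors have the preceding round. *)
  rewrite /electors [ancestors _]/= -/old [undup (_ :: _)]/=; case: ifP => //= _.
  by rewrite (_ : _ == _ = false) ?andbF //; lia.
rewrite !E; apply: eq_in_filter => w; rewrite mem_undup => wo.
by rewrite strongly_sees_signature // round_signature.
Qed.

End Signature.

End EventGraph.

Lemma eventually_fintype (T : finType) (Q : T -> nat -> Prop) :
  (forall a, exists M, forall m, M <= m -> Q a m) ->
  exists M, forall a m, M <= m -> Q a m.
Proof.
move=> /choice[f hf]; exists (\max_a f a) => a m hm; apply: hf.
exact: leq_trans (leq_bigmax a) hm.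
Qed.

(** * Events of honest hashgraphs *)

Section ConsistentEvents.
Context (Tx : eqType) (n ell : nat).
Local Notation event := (event Tx n ell).
Implicit Types (x y z w u e sp op : event) (b : body Tx n ell) (a : 'I_n).
Context (C : {set 'I_n}) (V : event -> Prop).

(** All that the combinatorics needs to know about the events held by honest parties over a whole
    execution; see [consistent_held]. *)
Record consistent : Prop := Consistent {
  consistent_anc : forall x y, V y -> x \in ancestors y -> V x;
  consistent_wf : forall x, V x -> well_formed x;
  consistent_honest : forall x y, V x -> V y -> creator x = creator y ->
    creator x \notin C -> x \in self_ancestors y \/ y \in self_ancestors x }.

Context (hC : 3 * #|C| < n) (hV : consistent).
Let V_anc := consistent_anc hV.
Let V_wf := consistent_wf hV.
Let V_honest := consistent_honest hV.

Lemma honest_unforked x a : V x -> a \notin C -> ~~ observes_fork_by x a.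
Proof.
move=> Vx aC; apply/negP => /hasP[y yx /hasP[z zx /andP[/eqP ya /and3P[/eqP yz]]]].
have [] := @V_honest y z (V_anc Vx yx) (V_anc Vx zx) yz; first by rewrite ya.
  by move=> /self_anc_anc ->.
by move=> /self_anc_anc ->.
Qed.

Lemma sees_honest x y : V x -> y \in ancestors x -> creator y \notin C -> sees x y.
Proof. by move=> Vx yx yC; rewrite /sees yx honest_unforked. Qed.

(* This is where the format condition on events is needed: without forks, an
   event of the same creator below the other-parent lies on the self-chain. *)
Lemma anc_self_anc z w y : V z -> ~~ observes_fork_by z (creator w) ->
  w \in ancestors z -> y \in ancestors z -> creator y = creator w ->
  w \in ancestors y -> w \in self_ancestors y.
Proof.
move=> Vz zF wz; elim: y => [b|b sp IHs op _] yz yw; first by rewrite /= !inE.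
rewrite mem_self_anc_child.
have spz : sp \in ancestors z.
  by apply: anc_trans yz; rewrite mem_anc_child anc_refl orbT.
have /and3P[/eqP spb _ nop] := V_wf (V_anc Vz yz).
have wb : creator w = author b by rewrite -yw.
rewrite mem_anc_child => /or3P[->//|h|wop]; first by rewrite IHs ?orbT // spb wb.
have [h|wsp] := boolP (w \in ancestors sp); first by rewrite IHs ?orbT // spb wb.
have spw : sp \in ancestors w.
  apply: contraNT zF => spw; apply/hasP; exists w => //; apply/hasP; exists sp => //.
  by rewrite /is_fork eqxx wb spb eqxx wsp spw.
case/hasP: nop; exists w => //; rewrite wb eqxx spw andbT /=.
by apply: contraNneq wsp => ->; apply: anc_refl.
Qed.

Lemma witness_self_anc x y : witness y -> round x = round y ->
  x \in self_ancestors y -> x = y.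
Proof.
case: y => [b|b sp op] wy xy; first by rewrite /= inE => /eqP.
rewrite mem_self_anc_child => /orP[/eqP//|/self_anc_anc/round_anc].
by move: wy; rewrite /witness /= xy; lia.
Qed.

Lemma honest_witness_uniq x y : V x -> V y -> creator x = creator y ->
  creator x \notin C -> witness x -> witness y -> round x = round y -> x = y.
Proof.
move=> Vx Vy xy xC wx wy rxy; case: (V_honest Vx Vy xy xC).
  exact: witness_self_anc.
by move=> /witness_self_anc ->.
Qed.

(** The two sets of intermediaries share an honest creator, whose two events lie on one self-chain.
    The upper one has both [w] and [w'] below it and observes no fork by their creator, so they lie
    on one self-chain too, where a round has only one witness. *)
Lemma strongly_seen_uniq y y' w w' : V y -> V y' ->
  strongly_sees y w -> strongly_sees y' w' ->
  witness w -> witness w' -> round w = round w' -> creator w = creator w' -> w = w'.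
Proof.
move=> Vy Vy' sw sw' ww ww' rww cww.
have [h [/creatorsP[u + uh] /creatorsP[u' + u'h] hnC]] := supermajorityI hC sw sw'.
rewrite !mem_filter => /andP[/andP[_ uw] uy] /andP[/andP[_ uw'] uy'].
wlog : y y' w w' u u' Vy Vy' ww ww' rww cww uh u'h {sw sw'} uw uw' uy uy' /
    u \in self_ancestors u'.
  move=> th; have Vu := V_anc Vy uy; have Vu' := V_anc Vy' uy'.
  case: (@V_honest u u' Vu Vu'); rewrite ?uh ?u'h // => uu.
    exact: (th y y' w w' u u').
  by symmetry; apply: (th y' y w' w u' u).
move=> /self_anc_anc uu.
have Vu' := V_anc Vy' uy'; have wu' := sees_anc uw'.
have wu : w \in ancestors u' := anc_trans (sees_anc uw) uu.
have uF : ~~ observes_fork_by u' (creator w') by case/andP: uw'.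
have [ww1|] := boolP (w \in ancestors w').
  by apply: witness_self_anc => //; apply: (@anc_self_anc u'); rewrite ?cww.
have [ww1 _|nww1 nww2] := boolP (w' \in ancestors w).
  by symmetry; apply: witness_self_anc => //; apply: (@anc_self_anc u').
case/negP: uF; apply/hasP; exists w => //; apply/hasP; exists w' => //.
by rewrite /is_fork cww eqxx nww1 nww2.
Qed.

(** An elector is determined by its creator, so counting votes amounts to counting parties. *)
Lemma count_electors y (f : pred event) : V y ->
  count f (electors y) = #|creators [seq w <- electors y | f w]|.
Proof.
move=> Vy; rewrite /creators cardsE -size_filter -(size_map (@creator Tx n ell)).
apply/esym/card_uniqP; rewrite map_inj_in_uniq ?filter_uniq ?undup_uniq //.
move=> w w'; rewrite !mem_filter => /andP[_ /andP[/and3P[h1 /eqP h2 h3] _]].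
move=> /andP[_ /andP[/and3P[h1' /eqP h2' h3'] _]].
by apply: (strongly_seen_uniq Vy Vy) => //; lia.
Qed.

Lemma size_electors y : V y -> size (electors y) = #|creators (electors y)|.
Proof. by move=> Vy; rewrite -count_predT count_electors // filter_predT. Qed.

(** [z] strongly sees every [w q'] through the intermediaries [v q]. The [w q] must differ from [z]
    because a round is computed from witnesses below the parents. *)
Lemma round_grows z r (v w : 'I_n -> event) : V z ->
  (forall q, q \notin C -> creator (v q) = q /\ v q \in ancestors z) ->
  (forall q, q \notin C -> [/\ creator (w q) = q, witness (w q), round (w q) = r & w q <> z]) ->
  (forall q q', q \notin C -> q' \notin C -> w q' \in ancestors (v q)) ->
  r < round z.
Proof.
move=> Vz hv hw wv.
have [q0 _ q0C] := supermajority_honest hC (cardC3 hC).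
have wz q : q \notin C -> w q \in ancestors z.
  by move=> qC; have [_] := hv q0 q0C; apply: anc_trans; apply: wv.
case: z Vz hv hw wz => [b|b sp op] Vz hv hw wz.
  by have := wz q0 q0C; have [_ _ _ h] := hw q0 q0C; rewrite /= inE => /eqP.
set z := Child b sp op in Vz hv hw wz.
have wold q : q \notin C -> w q \in ancestors sp ++ ancestors op.
  move=> qC; have [_ _ _ /eqP/negPf nwz] := hw q qC.
  by have := wz q qC; rewrite mem_anc_child -/z nwz -mem_cat.
have rmax : r <= maxn (round sp) (round op).
  have [_ _ <- _] := hw q0 q0C; have := wold q0 q0C; rewrite mem_cat.
  by case/orP => /round_anc; lia.
rewrite roundE; case: ifP => [|/negbT/negP h]; first by lia.
(* Parents beyond round [r] settle the claim, so only the case where their maximum is exactly [r] is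
   left. *)
rewrite ltn_neqAle rmax andbT; apply/negP => /eqP rE; apply: h.
apply: supermajorityS (cardC3 hC); apply/fintype.subsetP => q; rewrite inE => qC.
have [wq ww rw _] := hw q qC.
apply/creatorsP; exists (w q) => //; rewrite mem_filter wold // ww rw -rE eqxx andbT /=.
apply: supermajorityS (cardC3 hC); apply/fintype.subsetP => q'; rewrite inE => q'C.
have [vq' vz] := hv q' q'C.
apply/creatorsP; exists (v q') => //; rewrite mem_filter vz andbT.
by rewrite !sees_honest ?vq' ?wq ?wv //; apply: V_anc Vz vz.
Qed.

(** A fork observed by such an event is observed by an honest event, and thus spreads. A corrupted
    event that is merely held may show a fork that no honest event ever observes. *)
Definition core y : Prop := exists e, [/\ V e, creator e \notin C & y \in ancestors e].

Lemma core_V y : core y -> V y.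
Proof. by case=> e [Ve _]; apply: V_anc. Qed.

Lemma core_anc x y : core y -> x \in ancestors y -> core x.
Proof. by case=> e [Ve eC ye] xy; exists e; split=> //; apply: anc_trans ye. Qed.

Lemma core_honest e : V e -> creator e \notin C -> core e.
Proof. by move=> Ve eC; exists e; rewrite anc_refl. Qed.

(* A witness may owe its round to its other-parent only and, observing more
   forks, strongly see fewer witnesses than the latter.  But there are finitely
   many forking creators, so this happens only in finitely many rounds. *)
Lemma eventually_promoted :
  (forall e, V e -> creator e \notin C ->
    exists M, forall y, V y -> M <= round y -> e \in ancestors y) ->
  exists M, forall y, core y -> M <= round y -> promoted y.
Proof.
move=> spread.
have [M hM] : exists M, forall a m, M <= m -> forall e y, V e -> creator e \notin C ->
    observes_fork_by e a -> V y -> round y = m -> observes_fork_by y a.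
  apply: eventually_fintype => a.
  (* For each creator one honest event that observes a fork by it is enough: once that event lies
     below everything, so does the fork. *)
  have [[e [Ve eC ea]]|nF] :=
    pselect (exists e, [/\ V e, creator e \notin C & observes_fork_by e a]).
    have [M hM] := spread e Ve eC; exists M => m hm _ y _ _ _ Vy yr.
    by apply: observes_forkS ea; apply: hM; rewrite ?yr.
  by exists 0 => m _ e y Ve eC ea; case: nF; exists e.
exists (maxn M 2) => y cy; rewrite geq_max => /andP[yM y2].
(* [y'] has the round of [y], so by the choice of [M] it already observes every fork that [y]
   observes, and [y] strongly sees all electors of [y']. *)
have [y' [y'y ry' _ py']] := promoted_ancestor y2 (leqnn _).
apply: supermajorityS py'; apply: creatorsS => w.
rewrite !mem_electors ry' => /and4P[wy' -> -> sw]; rewrite (anc_trans wy' y'y) /=.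
apply: (strongly_seesS y'y _ sw) => a; case: (cy) => e [Ve eC ye] ya.
apply: (hM a (round y) yM e) => //; last exact: V_anc (core_V cy) y'y.
exact: observes_forkS ye ya.
Qed.

End ConsistentEvents.

(** * Elections *)

Section Elections.
Context (Tx : eqType) (n ell c : nat).
Local Notation event := (event Tx n ell).
Implicit Types (x y z w u e : event) (base f : event -> bool) (s : seq event).

Lemma tally_count f s :
  (tally_of f s).2 = count (fun z => f z == (tally_of f s).1) s.
Proof.
rewrite /tally_of; case: ifP => _ /=; apply: eq_count => z /=; first by rewrite eqb_id.
by rewrite eqbF_neg.
Qed.

Lemma tally_majority f s v :
  size s < 2 * count (fun z => f z == v) s -> (tally_of f s).1 = v.
Proof.
have := count_predC f s; rewrite /tally_of => <-.
have E1 : count (fun z => f z == true) s = count f s.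
  by apply: eq_count => z; rewrite eqb_id.
have E2 : count (fun z => f z == false) s = count (predC f) s.
  by apply: eq_count => z; rewrite eqbF_neg.
by case: v; rewrite ?E1 ?E2; case: ifP => //=; lia.
Qed.

Lemma tally_unanimous f s v : 0 < size s -> {in s, forall z, f z = v} ->
  tally_of f s = (v, size s).
Proof.
move=> s0 h; have E : count (fun z => f z == v) s = size s.
  by apply/eqP; rewrite -all_count; apply/allP => z /h /eqP.
have tv : (tally_of f s).1 = v by apply: tally_majority; rewrite E; lia.
by rewrite [LHS]surjective_pairing tally_count tv E.
Qed.

(* The election for [x] depends on [x] only through the votes [base] of the
   first round of voting.  The constant [base] false gives the election for all
   the witnesses that arrive too late to be seen by the voters. *)
Fixpoint vote_from base (d : nat) y : bool :=
  if d is d'.+1 then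
    if d' == 0 then base y
    else let: (v, m) := tally_of (vote_from base d') (electors y) in
         if (d %% c == 0) && ~~ supermajority n m
         then middle_bit (signature (body_of y)) else v
  else false.

Definition tally_from base d y := tally_of (vote_from base d.-1) (electors y).

Definition decides_from base d y : bool :=
  [&& 1 < d, 0 < d %% c & supermajority n (tally_from base d y).2].

Lemma vote_fromE d x y : vote c d x y = vote_from (fun y => sees y x) d y.
Proof.
elim: d y => [|d IHd] y //=; case: eqP => // _.
by rewrite (_ : vote c d x = vote_from (fun y => sees y x) d) //; apply/funext.
Qed.

Lemma decides_fromE x y :
  decides c x y = decides_from (fun y => sees y x) (round y - round x) y.
Proof.
rewrite /decides /count_votes /decides_from /tally_from.
rewrite (_ : vote c _ x = vote_from (fun y => sees y x) (round y - round x).-1) //.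
by apply/funext => z; apply: vote_fromE.
Qed.

Lemma eq_in_tally f f' s : {in s, f =1 f'} -> tally_of f s = tally_of f' s.
Proof.
move=> ff'; have E : count (predC f) s = count (predC f') s.
  by apply: eq_in_count => z /ff' /= ->.
by rewrite /tally_of E (eq_in_count ff').
Qed.

Lemma vote_from_late x d y : x \notin ancestors y ->
  vote_from (fun y => sees y x) d y = vote_from xpred0 d y.
Proof.
elim: d y => [|d IHd] y xy //=.
case: eqP => [_|_]; first by rewrite /sees (negPf xy).
rewrite (@eq_in_tally _ (vote_from xpred0 d)) // => z.
rewrite mem_electors => /and4P[zy _ _ _]; apply: IHd.
by apply: contra xy => /anc_trans; apply.
Qed.

Lemma decides_from_late x d y : x \notin ancestors y ->
  decides_from (fun y => sees y x) d y = decides_from xpred0 d y.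
Proof.
move=> xy; rewrite /decides_from /tally_from (@eq_in_tally _ (vote_from xpred0 d.-1)) // => z.
rewrite mem_electors => /and4P[zy _ _ _]; apply: vote_from_late.
by apply: contra xy => /anc_trans; apply.
Qed.

Context (C : {set 'I_n}) (V : event -> Prop).
Context (hC : 3 * #|C| < n) (hV : consistent C V) (hc : 1 < c).

(** Fewer than [n / 3] creators lie outside those voting [v] at [y], and shared creators have the
    same elector at both events. So fewer than half of the more than [2 * n / 3] electors of [y']
    can vote otherwise. *)
Lemma tally_agree f y y' : V y -> V y' -> promoted y' -> round y = round y' ->
  supermajority n (tally_of f (electors y)).2 ->
  (tally_of f (electors y')).1 = (tally_of f (electors y)).1.
Proof.
move=> Vy Vy' py' ryy'; set v := (tally_of f (electors y)).1.
rewrite tally_count -/v (count_electors hC hV) // => sv.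
apply: tally_majority; rewrite (size_electors hC hV) // (count_electors hC hV) //.
have := card_setI_ge (creators [seq w <- electors y | f w == v]) (creators (electors y')).
have /subset_leq_card : creators [seq w <- electors y | f w == v] :&: creators (electors y')
    \subset creators [seq w <- electors y' | f w == v].
  apply/fintype.subsetP => a; rewrite inE => /andP[/creatorsP[w + wa] /creatorsP[w' h' wa']].
  rewrite mem_filter => /andP[fw h]; apply/creatorsP; exists w' => //.
  rewrite mem_filter h' andbT; move: h h'; rewrite !mem_electors.
  move=> /and4P[_ h1 /eqP h2 h3] /and4P[_ h1' /eqP h2' h3'].
  suff <- : w = w' by [].
  by apply: (strongly_seen_uniq hC hV Vy Vy'); rewrite ?wa ?wa' //; lia.
by move: sv py'; rewrite /promoted /supermajority; lia.
Qed.

(** Fewer than [n / 3] of more than [2 * n / 3] electors are corrupted. *)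
Lemma tally_honest f v y : V y -> promoted y ->
  {in electors y, forall z, creator z \notin C -> f z = v} ->
  (tally_of f (electors y)).1 = v.
Proof.
move=> Vy py hf; apply: tally_majority.
rewrite (size_electors hC hV) // (count_electors hC hV) //.
have /subset_leq_card : creators (electors y) :\: C
    \subset creators [seq w <- electors y | f w == v].
  apply/fintype.subsetP => a; rewrite inE => /andP[aC /creatorsP[w hw wa]].
  by apply/creatorsP; exists w => //; rewrite mem_filter hw hf ?eqxx ?wa.
have := cardsID C (creators (electors y)).
have := subset_leq_card (finset.subsetIr (creators (electors y)) C).
by move: py; rewrite /promoted /supermajority; lia.
Qed.

Lemma promoted_electors y : V y -> promoted y -> supermajority n (size (electors y)).
Proof. by move=> Vy; rewrite (size_electors hC hV). Qed.

(* By [tally_agree], [v] is the only value that can have a supermajority in round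
   [r + d], so an honest witness votes [v] whether or not it uses its coin. *)
Lemma lucky_round base r d v y1 :
  (forall y, core C V y -> r + d <= round y -> promoted y) ->
  1 < d -> d %% c = 0 ->
  core C V y1 -> round y1 = r + d -> (tally_from base d y1).1 = v ->
  (forall z, V z -> creator z \notin C -> witness z -> round z = r + d ->
     middle_bit (signature (body_of z)) = v) ->
  exists i, forall y, core C V y -> round y = r + d + i ->
    decides_from base (d + i) y.
Proof.
move=> prom d1 dc cy1 ry1 ty1 coins.
have V_core y : core C V y -> V y := @core_V _ _ _ C V hV y.
have core_elector y z : core C V y -> z \in electors y -> core C V z.
  by move=> cy; rewrite mem_electors => /and4P[zy _ _ _]; apply: core_anc zy.
have vote_coin z : V z -> creator z \notin C -> witness z -> round z = r + d ->
    vote_from base d z = v.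
  move=> Vz zC wz rz; have bz := coins z Vz zC wz rz; move: ty1.
  rewrite /tally_from; case: d d1 dc {coins} rz ry1 prom => //= d d1 dc rz ry1 prom.
  have -> : d == 0 = false by lia.
  rewrite dc eqxx /= => ty1.
  case E : (tally_of _ (electors z)) => [v' m]; case: ifP => // /negbFE sm.
  have := @tally_agree (vote_from base d) z y1 Vz (V_core _ cy1).
  rewrite E /= ty1 => -> //; last by rewrite rz ry1.
  by apply: prom => //; rewrite ry1.
have d1c : d.+1 %% c != 0 by rewrite -addn1 -modnDml dc add0n modn_small.
have vote1 z : core C V z -> round z = r + d + 1 -> vote_from base d.+1 z = v.
  move=> cz rz /=; have -> : d == 0 = false by lia.
  rewrite [tally_of _ _]surjective_pairing (negPf d1c) /=.
  apply: tally_honest; [exact: V_core|by apply: prom => //; lia|].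
  move=> w wz wC; have cw := core_elector _ _ cz wz.
  move: wz; rewrite mem_electors => /and4P[_ ww /eqP rw _].
  by apply: vote_coin => //; [exact: V_core|lia].
have unanimous i : 0 < i -> (forall z, core C V z -> round z = r + d + i ->
     vote_from base (d + i) z = v) ->
   forall y, core C V y -> round y = r + d + i.+1 ->
   tally_from base (d + i.+1) y = (v, size (electors y)) /\
   supermajority n (size (electors y)).
  move=> i0 hi y cy ry.
  have sy : supermajority n (size (electors y)).
    by apply: promoted_electors; [exact: V_core|apply: prom => //; lia].
  split=> //; rewrite /tally_from addnS /=; apply: tally_unanimous.
    by move: sy; rewrite /supermajority; lia.
  move=> z zy; apply: hi; first exact: core_elector zy.
  by move: zy; rewrite mem_electors => /and4P[_ _ /eqP rz _]; lia.
(* Corrupted witnesses may still differ in round [r + d]. In the next round their votes are forced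
   by the honest majority as well, so the first unanimous tally is at distance [d + 2]. *)
have tally2 : forall y, core C V y -> round y = r + d + 2 ->
   tally_from base (d + 2) y = (v, size (electors y)) /\
   supermajority n (size (electors y)).
  by apply: unanimous => // z cz rz; rewrite addn1; apply: vote1.
(* Distance [d + 2] is a coin round only if [c = 2]. It then decides nothing, but a supermajority
   overrides the coin, so unanimity lasts until [d + 3]. *)
have [d2c|d2c] := eqVneq ((d + 2) %% c) 0; last first.
  exists 2 => y cy ry; have [ty sy] := tally2 y cy ry.
  by rewrite /decides_from ty sy lt0n d2c andbT /=; lia.
have tally3 : forall y, core C V y -> round y = r + d + 3 ->
   tally_from base (d + 3) y = (v, size (electors y)) /\
   supermajority n (size (electors y)).
  apply: unanimous => // z cz rz; have [] := tally2 z cz rz.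
  rewrite /tally_from addn2 /= => -> sz; rewrite sz andbF.
  by [].
have d3c : (d + 3) %% c != 0.
  by rewrite (_ : d + 3 = d + 2 + 1) -?addnA // addnA -modnDml d2c add0n modn_small.
exists 3 => y cy ry; have [ty sy] := tally3 y cy ry.
by rewrite /decides_from ty sy andbT lt0n d3c andbT; lia.
Qed.

End Elections.

(** * Protocol steps *)

Section Receive.
Context (Tx : eqType) (n ell : nat).
Local Notation event := (event Tx n ell).
Implicit Types (es : seq event) (l : local Tx n ell) (x y : event).

Definition anc_closed (H : seq event) : Prop :=
  forall x y, x \in H -> y \in ancestors x -> y \in H.

Lemma receive_sub es l x : x \in hashgraph l -> x \in hashgraph (receive es l).
Proof. by rewrite /= mem_cat => ->. Qed.

Lemma receive_hashgraph es l x :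
  x \in hashgraph (receive es l) ++ waiting (receive es l) ->
  x \in hashgraph l ++ waiting l \/ (x \in es /\ well_formed x).
Proof.
rewrite /= -catA !mem_cat; case: (x \in hashgraph l) => //=; first by left.
rewrite !mem_filter mem_undup mem_cat mem_filter.
have [xw|nxw] := boolP (x \in waiting l); first by left.
by case: (well_formed x); case: (x \in es) => //=; [right|rewrite !andbF..].
Qed.

Lemma receive_closed es l : anc_closed (hashgraph l) ->
  anc_closed (hashgraph (receive es l)).
Proof.
move=> clos x y; rewrite /= !mem_cat => /orP[xH|]; first by move=> /(clos _ _ xH) ->.
rewrite !mem_filter !mem_undup => /andP[/andP[/allP ready _] xp] yx.
have := ready y yx; rewrite mem_cat; case yH: (y \in hashgraph l) => //= ->.
(* Readiness passes to ancestors, so they are added in the same batch. *)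
by rewrite !andbT; apply/allP => z zy; apply: ready; apply: anc_trans zy yx.
Qed.

Lemma receive_shared es l x : anc_closed es -> all (@well_formed _ _ _) es ->
  x \in es -> x \in hashgraph (receive es l).
Proof.
move=> clos /allP wf xes; rewrite /= mem_cat mem_filter mem_undup mem_cat mem_filter xes.
rewrite wf //= orbT andbT; case: (x \in hashgraph l) => //=; rewrite andbT.
apply/allP => y yx; have yes := clos _ _ xes yx.
by rewrite !mem_cat mem_filter yes wf // !orbT.
Qed.

End Receive.

Section Step.
Context (Tx : eqType) (n ell c : nat) (C : {set 'I_n}) (hn : 1 < n).
Local Notation event := (event Tx n ell).
Local Notation state := (state Tx n ell).
Local Notation action := (action Tx n ell).
Local Notation step := (@step Tx n ell c C).
Local Notation authentic := (@authentic Tx n ell C).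
Implicit Types (st : state) (a : action) (j : 'I_n.-1) (s : ell.-tuple bool).
Implicit Types (p q : 'I_n) (x y e sp op : event) (l : local Tx n ell).

Definition last_of st p := last_event (party st p).
Definition graph_of st p := hashgraph (party st p).
Definition own_of st p : seq event :=
  if last_of st p is Some y then self_ancestors y else [::].

(** Whether an event is created, and with which parents, is settled before the quantifier over its
    signature. Bets rely on this order. *)
Lemma last_on_message p m clock l :
  (forall s, last_event (on_message c p m clock s l) = last_event l /\
     buffer (on_message c p m clock s l) = buffer l /\
     hashgraph (on_message c p m clock s l) = hashgraph (receive (shared m) l)) \/
  exists sp op, [/\ last_event l = Some sp, creator op != p,
    op \in hashgraph (receive (shared m) l), latest m = Some op &
    forall s, last_event (on_message c p m clock s l)
              = Some (Child (Body p (buffer l) clock s) sp op) /\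
       hashgraph (on_message c p m clock s l)
       = rcons (hashgraph (receive (shared m) l)) (Child (Body p (buffer l) clock s) sp op)].
Proof.
rewrite /on_message; case: (latest m) => [op|]; last by left.
case El: (last_event l) => [sp|]; last by left=> s; rewrite /= /create_child /= El.
case: (boolP ((op \in hashgraph (receive (shared m) l)) && (creator op != p))) => [h|/negPf h].
  right; exists sp, op; case/andP: (h) => h1 h2; split=> // s.
  by rewrite /create_child (_ : last_event (receive _ _) = Some sp) ?h.
by left=> s; rewrite /create_child (_ : last_event (receive _ _) = Some sp) ?h.
Qed.

Lemma waiting_on_message p m clock s l :
  waiting (on_message c p m clock s l) = waiting (receive (shared m) l).
Proof.
rewrite /on_message; case: (latest m) => [op|] //.
by rewrite /create_child; case: (last_event _) => [sp|] //; case: ifP.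
Qed.

Lemma committed_on_message p m clock s l :
  let l' := on_message c p m clock s l in
  committed l' = committed l ++ newly_ordered c (hashgraph l') (committed l).
Proof.
rewrite /on_message; case: (latest m) => [op|] //=.
by rewrite /create_child; case: (last_event _) => [sp|] //; case: ifP.
Qed.

Lemma only_actor_moves st a : exists p, forall q j s, q != p ->
  party (step a j s st) q = party st q.
Proof.
case: a => [p tx|p clock|i clock|f m].
- by exists p => q j s qp; rewrite /= /set_party (negPf qp).
- exists p => q j s qp /=; case: ifP => // _; case: (last_event _) => [y|] //=.
  by rewrite /set_party (negPf qp).
- rewrite /=; case: (onth (network st) i) => [m|]; last by exists (Ordinal (ltnW hn)).
  by exists (dest m) => q j s qp; case: ifP => // _ /=; rewrite /set_party (negPf qp).
- by exists f => q j s qp; rewrite /=; case: ifP.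
Qed.


(** Clock and parents are again chosen before [j] and [s]. *)
Lemma step_event st a q :
  (forall j s, last_of (step a j s st) q = last_of st q /\
     {subset buffer (party st q) <= buffer (party (step a j s st) q)}) \/
  exists clock, (last_of st q = None /\ forall j s,
      last_of (step a j s st) q = Some (Genesis (Body q (buffer (party st q)) clock s))) \/
    exists sp op, last_of st q = Some sp /\ forall j s,
      last_of (step a j s st) q = Some (Child (Body q (buffer (party st q)) clock s) sp op).
Proof.
rewrite /last_of; case: a => [p tx|p clock|i clock|f m].
- left=> j s; rewrite /= /set_party; case: eqP => [->|//] /=; split=> // y.
  by rewrite mem_rcons inE => ->; rewrite orbT.
- have [pC|/negPf pC] := boolP (p \in C); first by left=> j s; rewrite /= pC; split.
  case El: (last_event (party st p)) => [y|]; first by left=> j s; rewrite /= pC El; split.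
  have [->|/negPf qp] := eqVneq q p; last by left=> j s; rewrite /= pC El /= /set_party qp; split.
  by right; exists clock; left; split=> // j s; rewrite /= pC El /= /set_party eqxx.
- case Em: (onth (network st) i) => [m|]; last by left=> j s; rewrite /= Em; split.
  have [h|/negPf h] := boolP [&& dest m \notin C, i \notin delivered st
             & isSome (last_event (party st (dest m)))]; last by left=> j s; rewrite /= Em h; split.
  have [->|/negPf qm] := eqVneq q (dest m); last first.
    by left=> j s; rewrite /= Em h /= /set_party qm; split.
  have E j s : party (step (Deliver Tx n ell i clock) j s st) (dest m) =
      on_message c (dest m) m clock s (party st (dest m)).
    by rewrite /= Em h /= /set_party eqxx.
  case: (last_on_message (dest m) m clock (party st (dest m))) => [h'|[sp [op [h1 _ _ _ h2]]]].
    by left=> j s; rewrite E; have [-> [-> _]] := h' s; split.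
  by right; exists clock; right; exists sp, op; split=> // j s; rewrite E; case: (h2 s).
- by left=> j s; rewrite /=; case: ifP; split.
Qed.

Lemma step_last st a j s q y : last_of st q = Some y ->
  exists2 y', last_of (step a j s st) q = Some y' & y \in self_ancestors y'.
Proof.
move=> ly; case: (step_event st a q) => [h|[clock [[E _]|[sp [op [E h]]]]]].
- by exists y; [have [->] := h j s|apply: self_anc_refl].
- by rewrite E in ly.
- have -> : y = sp by move: E; rewrite ly => -[].
  by eexists; [apply: h|rewrite mem_self_anc_child self_anc_refl orbT].
Qed.

Lemma authentic_step st a j s x : authentic st x -> authentic (step a j s st) x.
Proof.
rewrite /authentic => /orP[->//|]; case E: (last_event _) => [y|//] xy.
have [y' ly' yy'] := step_last a j s E; apply/orP; right.
by rewrite -/(last_of _ _) ly'; apply: self_anc_trans yy'.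
Qed.

Definition local_invariant st p l : Prop :=
  [/\ forall x, x \in hashgraph l ++ waiting l -> well_formed x /\ authentic st x,
      anc_closed (hashgraph l) &
      forall y, last_event l = Some y -> creator y = p /\ y \in hashgraph l].

(** The last clause prevents a message from counting as delivered before it is sent. *)
Definition state_invariant st : Prop :=
  [/\ forall p, p \notin C -> local_invariant st p (party st p),
      forall i m x, onth (network st) i = Some m -> x \in shared m -> authentic st x &
      forall i, i \in delivered st -> i < size (network st)].

Lemma invariant_initial : state_invariant (initial Tx n ell).
Proof. by split=> //= i m x; rewrite onth0n. Qed.

Lemma local_invariant_receive st p l es : local_invariant st p l ->
  (forall x, x \in es -> authentic st x) -> local_invariant st p (receive es l).
Proof.
move=> [ok clos own] hes; split; last 2 first.
- exact: receive_closed.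
- by move=> y /own[-> h]; split=> //; apply: receive_sub.
by move=> x /receive_hashgraph[/ok//|[/hes]].
Qed.

(** By unforgeability, every event of [p] below [op] lies on the self-chain of [sp], hence not
    strictly above [sp]. *)
Lemma well_formed_new st p clock s txs sp op : p \notin C ->
  last_of st p = Some sp -> creator sp = p -> creator op != p ->
  (forall z, z \in ancestors op -> authentic st z) ->
  well_formed (Child (Body p txs clock s) sp op).
Proof.
move=> pC lsp csp cop hop /=; rewrite csp eqxx cop /=.
apply/hasPn => z /hop; rewrite /authentic; case: eqP => //= -> .
rewrite (negPf pC) /= -/(last_of _ _) lsp => /self_anc_anc zsp.
by rewrite negb_and -implybE; apply/implyP => zn; apply: contra zn => /(anc_antisym zsp) ->.
Qed.

Lemma local_invariant_on_message st st' p m clock s : p \notin C ->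
  local_invariant st p (party st p) ->
  (forall x, x \in shared m -> authentic st x) ->
  (forall x, authentic st x -> authentic st' x) ->
  party st' p = on_message c p m clock s (party st p) ->
  local_invariant st' p (party st' p).
Proof.
move=> pC inv hm hauth stp; set l := party st p in inv stp.
have [ok1 clos1 own1] := local_invariant_receive inv hm.
rewrite stp; case: (last_on_message p m clock l) => [/(_ s)[El [_ Eh]]|].
  split; rewrite ?El ?Eh ?waiting_on_message // => x /ok1[? /hauth].
  by [].
move=> [sp [op [lsp cop opH _ /(_ s)[El Eh]]]].
have [csp spH] := own1 sp lsp.
set x := Child _ _ _ in El Eh.
have wfx : well_formed x.
  apply: (@well_formed_new st) => // z zop.
  by have [] := ok1 z; rewrite // mem_cat (clos1 op).
have ax : authentic st' x.
  rewrite /authentic /creator /= (negPf pC) /= stp El.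
  exact: self_anc_refl.
split; rewrite ?El ?Eh ?waiting_on_message.
- move=> z; rewrite -cats1 mem_cat mem_cat inE orbAC -mem_cat => /orP[/ok1[? /hauth]//|/eqP ->].
  by [].
- move=> z y; rewrite !mem_rcons !inE => /orP[/eqP ->|zH].
    rewrite mem_anc_child => /or3P[->//|h|h]; apply/orP; right; exact: clos1 h.
  by move=> h; apply/orP; right; exact: clos1 h.
- by move=> _ [<-]; rewrite mem_rcons inE eqxx.
Qed.

Lemma local_invariant_mono st st' p l : (forall x, authentic st x -> authentic st' x) ->
  local_invariant st p l -> local_invariant st' p l.
Proof. by move=> h [ok clos own]; split=> // x /ok[? /h]. Qed.

Lemma invariant_step st a j s : state_invariant st -> state_invariant (step a j s st).
Proof.
move=> [loc net del]; set st' := step a j s st.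
have auth x : authentic st x -> authentic st' x := @authentic_step st a j s x.
have loc' p : p \notin C -> local_invariant st' p (party st p).
  by move=> /loc; apply: local_invariant_mono.
have net' i m x : onth (network st) i = Some m -> x \in shared m -> authentic st' x.
  by move=> h1 h2; apply/auth/(net i m).
have idle : st' = st -> state_invariant st' by move=> ->.
move: idle; rewrite {}/st' in auth loc' net' *.
case: a auth loc' net' => [p tx|p clock|i clock|f m].
- move=> auth loc' net' _; split=> //= q qC; have := loc' q qC.
  by rewrite /set_party; case: eqP => // ->.
- rewrite /=; case: ifP => [_ _ _ _|/negbT pC]; first by apply.
  case El: (last_event (party st p)) => [y|] auth loc' net' _.
    split=> //=; last by move=> i /del; rewrite size_rcons; lia.
    move=> i m x; rewrite -cats1 onth_cat; case: ifP => [_|_]; first exact: net'.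
    move=> /onth1P[_ <-] /= xH; apply: auth.
    by have [+ _ _] := loc p pC => /(_ x); rewrite mem_cat xH => -[].
  set g := Genesis _ in auth loc' net' *.
  have ag : authentic (step (Wake Tx ell p clock) j s st) g.
    apply/orP; right; rewrite (_ : last_event _ = Some g) ?self_anc_refl //.
    by rewrite /= (negPf pC) El /= /set_party eqxx.
  rewrite /= (negPf pC) El in ag; split=> //=.
  + move=> q qC; have := loc' q qC; rewrite /set_party.
    case: eqP => [->|//] [ok clos own]; split=> /=.
    * move=> x; rewrite mem_cat mem_rcons inE -orbA -mem_cat => /orP[/eqP ->|/ok//].
      by split=> //; exact: ag.
    * move=> x y; rewrite !mem_rcons !inE => /orP[/eqP ->|xH].
        by rewrite /= inE => ->.
      by move=> h; apply/orP; right; exact: clos h.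
    * by move=> _ [<-]; rewrite mem_rcons inE eqxx.
  + move=> i m x; rewrite onth_cat; case: ifP => [_|_]; first exact: net'.
    rewrite onth_map; case: (onth _ _) => //= q -[<-] /=; rewrite inE => /eqP ->.
    exact: ag.
  + by move=> i /del; rewrite size_cat; lia.
- rewrite /=; case Em: (onth (network st) i) => [m|]; last by move=> _ _ _; apply.
  case: ifP => [/and3P[pC _ _]|_ _ _ _]; last by apply.
  move=> auth loc' net' _; split=> //=.
  + move=> q qC; have [->|/negPf qm] := eqVneq q (dest m); last first.
      by rewrite [X in local_invariant _ _ X]/set_party qm; exact: loc'.
    set st' := State _ _ _ in auth loc' net' *.
    have E : party st' (dest m) = on_message c (dest m) m clock s (party st (dest m)).
      by rewrite /= /set_party eqxx.
    rewrite -/(party st' (dest m)).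
    have h := @local_invariant_on_message st st' (dest m) m clock s pC (loc _ pC) _ auth E.
    by apply: h => x; apply: net Em.
  + move=> k; rewrite mem_rcons inE => /orP[/eqP ->|/del//].
    by rewrite -onthTE Em.
- rewrite /=; case: ifP => [/and3P[_ /allP h _]|_ _ _ _]; last by apply.
  move=> auth loc' net' _; split=> //=; last by move=> i /del; rewrite size_rcons; lia.
  move=> i m' x; rewrite -cats1 onth_cat; case: ifP => [_|_]; first exact: net'.
  by move=> /onth1P[_ <-] /h; apply: auth.
Qed.

Lemma step_graph st a j s p x : x \in graph_of st p -> x \in graph_of (step a j s st) p.
Proof.
rewrite /graph_of; case: a => [q tx|q clock|i clock|f m] /= xp.
- by rewrite /set_party; case: eqP => // <-.
- case: ifP => // _; case: (last_event _) => [y|] //=; rewrite /set_party; case: eqP => // <- /=.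
  by rewrite mem_rcons inE xp orbT.
- case: (onth _ _) => [m|] //; case: ifP => // _ /=; rewrite /set_party; case: eqP => // E.
  rewrite -E; case: (last_on_message p m clock (party st p)) => [/(_ s)[_ [_ ->]]|].
    exact: receive_sub.
  move=> [sp [op [_ _ _ _ /(_ s)[_ ->]]]].
  by rewrite mem_rcons inE receive_sub ?orbT.
- by case: ifP.
Qed.

Lemma step_network st a j s i m : onth (network st) i = Some m ->
  onth (network (step a j s st)) i = Some m.
Proof.
move=> h; have hi : i < size (network st) by rewrite -onthTE h.
case: a => [q tx|q clock|i' clock|f m'] //=.
- case: ifP => // _; case: (last_event _) => [y|] //=; rewrite -?cats1 onth_cat hi //.
- by case: (onth _ i') => [m'|] //; case: ifP.
- by case: ifP => // _; rewrite /= -cats1 onth_cat hi.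
Qed.

Lemma step_sync st p clock j s y : p \notin C -> last_of st p = Some y ->
  onth (network (step (Wake Tx ell p clock) j s st)) (size (network st)) =
  Some (Message (lift p j) (graph_of st p) (Some y)).
Proof.
rewrite /last_of /= => /negPf -> ->.
by rewrite -cats1 onth_cat ltnn subnn.
Qed.

Lemma step_delivery st a j s i m : state_invariant st -> onth (network st) i = Some m ->
  i \notin delivered st -> i \in delivered (step a j s st) ->
  [/\ dest m \notin C, last_of st (dest m) <> None & exists clock,
    party (step a j s st) (dest m) = on_message c (dest m) m clock s (party st (dest m))].
Proof.
move=> inv Em /negPf nd; case: a => [q tx|q clock|i' clock|f m'] //=.
- by rewrite nd.
- by case: ifP => _; [|case: (last_event _) => [y|]]; rewrite /= nd.
- case Em': (onth (network st) i') => [m'|]; last by rewrite nd.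
  case: ifP => [/and3P[pC _ l]|_]; last by rewrite nd.
  rewrite /= mem_rcons inE nd orbF => /eqP ii'.
  move: Em'; rewrite -ii' Em => -[mm']; rewrite -mm' in pC l *.
  split=> //; first by move: l; rewrite /last_of; case: last_event.
  by exists clock; rewrite /set_party eqxx.
- by case: ifP => _; rewrite /= nd.
Qed.

(* The sync message holds the whole hashgraph of its sender, so nothing of it
   has to wait. *)
Lemma sync_received st p q m clock s y :
  anc_closed (shared m) -> all (@well_formed _ _ _) (shared m) -> latest m = Some y ->
  y \in shared m -> creator y = q -> q != p -> last_of st p <> None ->
  let l' := on_message c p m clock s (party st p) in
  {subset shared m <= hashgraph l'} /\
  exists2 sp, last_of st p = Some sp &
   last_event l' = Some (Child (Body p (buffer (party st p)) clock s) sp y).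
Proof.
move=> clos wf ly ym yq qp; rewrite /last_of.
case El: (last_event _) => [sp|]; last by move=> /(_ erefl).
move=> _; set l' := on_message _ _ _ _ _ _.
have sub x : x \in shared m -> x \in hashgraph (receive (shared m) (party st p)).
  exact: receive_shared.
case: (last_on_message p m clock (party st p)) => [/(_ s)[E [_ Eh]]|].
  move: E; rewrite /on_message ly /create_child.
  rewrite (_ : last_event (receive _ _) = Some sp) ?El //.
  rewrite (sub y ym) yq qp /= => -[E].
  have /andP[/negP[]] := child_notin_anc (Body p (buffer (party st p)) clock s) sp y.
  by rewrite E anc_refl.
move=> [sp' [op [E _ _ lop /(_ s)[Ep Eh]]]].
move: E lop Ep Eh; rewrite El ly => -[<-] [<-] Ep Eh.
rewrite -/l' in Ep Eh; split; last by exists sp.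
by move=> x /sub xl; rewrite Eh mem_rcons inE xl orbT.
Qed.

End Step.

(** * Bets on coins *)

Section Bets.
Context (Tx : eqType) (n ell c : nat) (C : {set 'I_n}).
Local Notation event := (event Tx n ell).
Local Notation state := (state Tx n ell).
Local Notation action := (action Tx n ell).
Implicit Types (st : state) (a : action) (q : 'I_n) (e : event).

Definition coin e : bool := middle_bit (signature (body_of e)).

Definition own_witness st q r e : Prop :=
  [/\ q \notin C, e \in own_of st q, witness e & round e = r].

Definition flipped st r : {set 'I_n} :=
  finset (fun q => (q \notin C) && has (fun e => witness e && (round e == r)) (own_of st q)).

(** The second clause ties [b] to the election: some honest witness of the coin round has found the
    majority [b], which is what [lucky_round] needs. *)
Definition winning (base : event -> bool) st r d (b : bool) : Prop :=
  (forall q e, own_witness st q (r + d) e -> coin e = b) /\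
  (0 < #|flipped st (r + d)| ->
   exists q e, own_witness st q (r + d) e /\ (tally_from c base d e).1 = b).

(** [birth] is the new event as a function of its still unknown signature. *)
Definition births st a q (birth : ell.-tuple bool -> event) : Prop :=
  q \notin C /\ exists clock sp op,
  [/\ last_of st q = Some sp,
      forall s, birth s = Child (Body q (buffer (party st q)) clock s) sp op &
      forall j s, last_of (step c C a j s st) q = Some (birth s)].

(* The action [a] lets an honest party create its witness of the coin round
   [r + d]; [i] such witnesses exist already, their coins agree, and [b] is the
   value for which the remaining coins should come up.  All this is known before
   the coin of the new witness is flipped. *)
Definition bet (base : event -> bool) r (i : nat) (b : bool) st a : Prop :=
  exists q birth d,
  [/\ births st a q birth, 1 < d, d %% c = 0
    & forall s, witness (birth s) /\ round (birth s) = r + d] /\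
  [/\ #|flipped st (r + d)| = i, winning base st r d b
    & i = 0 -> forall s, (tally_from c base d (birth s)).1 = b].

Lemma flippedP st r q :
  reflect (exists e, own_witness st q r e) (q \in flipped st r).
Proof.
rewrite inE; apply: (iffP andP) => [[qC /hasP[e eq /andP[we /eqP re]]]|[e [qC eq we re]]].
  by exists e.
by split=> //; apply/hasP; exists e => //; rewrite we re /=.
Qed.

End Bets.

Lemma infinitely_often_or (A B : nat -> Prop) :
  (forall K, exists2 k, K <= k & A k \/ B k) ->
  (forall K, exists2 k, K <= k & A k) \/ (forall K, exists2 k, K <= k & B k).
Proof.
move=> h; have [hA|/existsNP[K nA]] := pselect (forall K, exists2 k, K <= k & A k); first by left.
right=> K'; have [k] := h (maxn K K'); rewrite geq_max => /andP[Kk K'k] [Ak|]; last by exists k.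
by case: nA; exists k.
Qed.

(** * Executions *)

Section Execution.
Context (Tx : eqType) (n ell c : nat) (C : {set 'I_n}) (hn : 1 < n).
Context (hC : 3 * #|C| < n) (hc : 1 < c).
Context (acts : nat -> action Tx n ell) (partner : nat -> 'I_n.-1).
Context (sg : nat -> ell.-tuple bool).
Local Notation event := (event Tx n ell).
Local Notation st := (run c C acts partner sg).
Implicit Types (p q : 'I_n) (k K : nat) (x y e z : event).

Definition own k p : seq event := own_of (st k) p.

Definition held x : Prop := exists k p, p \notin C /\ x \in graph_of (st k) p.

Lemma invariant_run k : state_invariant C (st k).
Proof. by elim: k => [|k IHk]; [apply: invariant_initial|apply: invariant_step]. Qed.

Lemma last_mono k K p y : k <= K -> last_of (st k) p = Some y ->
  exists2 y', last_of (st K) p = Some y' & y \in self_ancestors y'.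
Proof.
move=> kK ly; elim: K kK => [|K IHK].
  by rewrite leqn0 => /eqP <-; exists y => //; apply: self_anc_refl.
rewrite leq_eqVlt => /orP[/eqP <-|]; first by exists y => //; apply: self_anc_refl.
move=> /IHK[y1 ly1 yy1]; have [y2 ly2 y12] := step_last c C (acts K) (partner K) (sg K) ly1.
by exists y2 => //; apply: self_anc_trans y12.
Qed.

Lemma own_mono k K p e : k <= K -> e \in own k p -> e \in own K p.
Proof.
rewrite /own /own_of => kK; case E: (last_of (st k) p) => [y|] // ey.
by have [y' -> yy'] := last_mono kK E; apply: self_anc_trans yy'.
Qed.

Lemma graph_mono k K p x : k <= K -> x \in graph_of (st k) p -> x \in graph_of (st K) p.
Proof.
move=> kK xk; elim: K kK => [|K IHK]; first by rewrite leqn0 => /eqP <-.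
rewrite leq_eqVlt => /orP[/eqP <-|/IHK] //.
exact: step_graph.
Qed.

Lemma network_mono k K i m : k <= K -> onth (network (st k)) i = Some m ->
  onth (network (st K)) i = Some m.
Proof.
move=> kK h; elim: K kK => [|K IHK]; first by rewrite leqn0 => /eqP <-.
rewrite leq_eqVlt => /orP[/eqP <-|/IHK] //.
exact: step_network.
Qed.

Lemma own_creator k p e : p \notin C -> e \in own k p -> creator e = p.
Proof.
move=> pC; rewrite /own /own_of; case E: (last_of _ _) => [y|] // ey.
have [loc _ _] := invariant_run k; have [ok clos own] := loc p pC.
have [yp yg] := own y E; rewrite -yp; elim: y yg ey {E yp} => [b|b sp IHs op _] yg.
  by rewrite /= inE => /eqP->.
rewrite mem_self_anc_child => /orP[/eqP->//|/IHs ->].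
  have [|/and3P[/eqP //]] := ok (Child b sp op); by rewrite mem_cat yg.
by apply: clos yg _; rewrite mem_anc_child anc_refl orbT.
Qed.

Lemma own_held k p e : p \notin C -> e \in own k p -> held e.
Proof.
move=> pC; rewrite /own /own_of; case E: (last_of _ _) => [y|] // ey.
have [loc _ _] := invariant_run k; have [ok clos own] := loc p pC.
have [yp yg] := own y E; exists k, p; split=> //.
exact: clos yg (self_anc_anc ey).
Qed.

Lemma held_own x : held x -> creator x \notin C -> exists k, x \in own k (creator x).
Proof.
move=> [k [p [pC xg]]] /negPf xC; exists k.
have [loc _ _] := invariant_run k; have [ok _ _] := loc p pC.
have [|_] := ok x; first by rewrite mem_cat xg.
by rewrite /authentic xC /= /own /own_of /last_of; case: (last_event _).
Qed.

Lemma own_total k p x y : x \in own k p -> y \in own k p ->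
  x \in self_ancestors y \/ y \in self_ancestors x.
Proof. by rewrite /own /own_of; case: (last_of _ _) => // z; apply: self_anc_total. Qed.

Lemma consistent_held : consistent C held.
Proof.
split.
- move=> x y [k [p [pC xg]]] yx; exists k, p; split=> //.
  by have [loc _ _] := invariant_run k; have [_ clos _] := loc p pC; apply: clos yx.
- move=> x [k [p [pC xg]]].
  have [loc _ _] := invariant_run k; have [ok _ _] := loc p pC.
  by have [|] := ok x; rewrite ?mem_cat ?xg.
- move=> x y hx hy xy xC; have [k xk] := held_own hx xC.
  have [|k' yk] := held_own hy; first by rewrite -xy.
  apply: (@own_total (maxn k k') (creator x)); first by apply: own_mono xk; apply: leq_maxl.
  by rewrite xy; apply: own_mono yk; apply: leq_maxr.
Qed.

(** * Spreading of honest events and growth of rounds *)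

Context (wakes : forall p (j : 'I_n.-1) K, p \notin C ->
  exists k clock, [/\ K <= k, acts k = Wake Tx ell p clock & partner k = j]).
Context (delivers : forall k i m, onth (network (st k)) i = Some m -> dest m \notin C ->
  exists K, i \in delivered (st K)).

Lemma eventually_created p : p \notin C -> exists k y, last_of (st k) p = Some y.
Proof.
move=> pC; have j : 'I_n.-1 by exists 0; lia.
have [k [clock [_ ak _]]] := wakes j 0 pC.
case E: (last_of (st k) p) => [y|]; first by exists k, y.
exists k.+1, (Genesis (Body p (buffer (party (st k) p)) clock (sg k))).
rewrite /last_of /= ak /= (negPf pC); move: E; rewrite /last_of => ->.
by rewrite /= /set_party eqxx.
Qed.

Lemma eventually_synced p q K y : p \notin C -> q \notin C -> p != q ->
  last_of (st K) p = Some y ->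
  exists k, [/\ K <= k,
    committed (party (st k.+1) q) = committed (party (st k) q) ++
      newly_ordered c (graph_of (st k.+1) q) (committed (party (st k) q)),
    {subset graph_of (st K) p <= graph_of (st k.+1) q} &
    exists clock sp y', [/\ last_of (st k) q = Some sp, y \in ancestors y' &
      last_of (st k.+1) q =
        Some (Child (Body q (buffer (party (st k) q)) clock (sg k)) sp y')]].
Proof.
move=> pC qC pq ly.
have [j jq _] := unlift_some pq.
have [k1 [clock [Kk1 ak1 pk1]]] := wakes j K pC.
have [y1 ly1 yy1] := last_mono Kk1 ly.
set i := size (network (st k1)).
have net1 : onth (network (st k1.+1)) i = Some (Message q (graph_of (st k1) p) (Some y1)).
  by rewrite /= ak1 pk1 (step_sync _ _ _ _ pC ly1) -jq.
have [K2 hK2] := delivers net1 qC.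
(* The step before the first time at which the message counts as delivered is the one in which [q]
   processes it. *)
have [k2 ik2 k2min] := ex_minnP (ex_intro (fun k => i \in delivered (st k)) K2 hK2).
have nd k : k <= k1 -> i \notin delivered (st k).
  move=> kk1; apply/negP => h; have [_ _ del] := invariant_run k.
  have := del i h; rewrite -onthTE; case E: (onth _ _) => [m|] // _.
  have : i < size (network (st k1)) by rewrite -onthTE (network_mono kk1 E).
  by rewrite /i ltnn.
have nd1 : i \notin delivered (st k1.+1).
  rewrite /= ak1 /=; have := nd k1 (leqnn _); case: ifP => // _.
  by case: (last_event _) => [z|].
case: k2 ik2 k2min => [|k] ik kmin; first by [].
have k1k : k1 < k.
  rewrite ltnNge leq_eqVlt; apply/negP => /orP[/eqP kE|kk1].
    by move: nd1; rewrite -kE ik.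
  by move: (nd _ kk1); rewrite ik.
have ndk : i \notin delivered (st k) by apply/negP => /kmin; lia.
have netk := network_mono k1k net1.
have [_ lq [clock' Eq]] := step_delivery (invariant_run k) netk ndk ik.
rewrite -/(run c C acts partner sg k.+1) /= in Eq lq.
have [loc _ _] := invariant_run k1; have [ok clos own1] := loc p pC.
have [y1p y1g] := own1 y1 ly1.
have wf : all (@well_formed _ _ _) (graph_of (st k1) p).
  by apply/allP => x xg; have [|] := ok x; rewrite ?mem_cat ?xg.
have := @sync_received _ _ _ c (st k) q p (Message q (graph_of (st k1) p) (Some y1))
  clock' (sg k) y1 clos wf erefl y1g y1p pq lq.
rewrite /= => -[sub [sp lsp lx]].
exists k; split.
- by lia.
- by rewrite /graph_of /= Eq committed_on_message.
- move=> x xg; rewrite /graph_of /= Eq; apply: sub; exact: graph_mono xg.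
- exists clock', sp, y1; split=> //; first exact: self_anc_anc.
  by rewrite /last_of /= Eq.
Qed.

Lemma other_honest p : exists2 q, q \notin C & q != p.
Proof.
have : 1 < #|finset.setC C|.
  have := cardC3 hC; rewrite /supermajority; move: #|_| => m; clear -hn; lia.
rewrite (cardsD1 p) => h.
have /card_gt0P[q] : 0 < #|finset.setC C :\ p|.
  by move: h; case: (p \in _); rewrite ?add1n ?add0n // => /ltnW.
by rewrite !inE => /andP[qp qC]; exists q.
Qed.

Lemma eventually_received p y K : p \notin C -> last_of (st K) p = Some y ->
  exists K', forall q k, K' <= k -> q \notin C ->
    exists2 z, last_of (st k) q = Some z & y \in ancestors z.
Proof.
move=> pC ly; apply: eventually_fintype => q.
have [qC|qC] := boolP (q \in C); first by exists 0.
have [<-|pq] := eqVneq p q.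
  exists K => k Kk _; have [z lz yz] := last_mono Kk ly.
  by exists z => //; apply: self_anc_anc.
have [k1 [_ _ _ [clock [sp [y' [_ yy' lx]]]]]] := eventually_synced pC qC pq ly.
exists k1.+1 => k kk1 _; have [z lz xz] := last_mono kk1 lx; exists z => //.
apply: anc_trans yy' (anc_trans _ (self_anc_anc xz)).
by rewrite mem_anc_child anc_refl !orbT.
Qed.

Lemma held_last x : held x -> creator x \notin C ->
  exists k y, last_of (st k) (creator x) = Some y /\ x \in self_ancestors y.
Proof.
move=> hx xC; have [k] := held_own hx xC; rewrite /own /own_of.
by case E: (last_of _ _) => [y|] // xy; exists k, y.
Qed.

Lemma last_own k p y : last_of (st k) p = Some y -> y \in own k p.
Proof. by rewrite /own /own_of => ->; apply: self_anc_refl. Qed.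

Lemma own_round k p : exists r, forall e, e \in own k p -> round e <= r.
Proof.
rewrite /own /own_of; case: (last_of _ _) => [y|]; last by exists 0.
by exists (round y) => e /self_anc_anc/round_anc.
Qed.

Lemma rounds_bounded k : exists r, forall p e, e \in own k p -> round e <= r.
Proof.
have [r hr] : exists r, forall p r', r <= r' -> forall e, e \in own k p -> round e <= r'.
  apply: eventually_fintype => p; have [r hr] := own_round k p.
  by exists r => r' rr' e /hr; lia.
by exists r => p; apply: hr.
Qed.

(** Once all honest parties have received [e], all their new events are above it. The bound [R] on
    the rounds of their earlier events turns this condition on time into one on rounds. *)
Lemma held_spread e : held e -> creator e \notin C ->
  exists M, forall y, held y -> M <= round y -> e \in ancestors y.
Proof.
move=> he eC; have [K [y [ly ey]]] := held_last he eC.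
have [K' hK'] := eventually_received eC ly.
have [R hR] := rounds_bounded K'.
have late h : held h -> creator h \notin C -> R < round h -> e \in ancestors h.
  move=> hh hnC Rh; have [k hk] := held_own hh hnC.
  have [z lz yz] := hK' _ _ (leqnn K') hnC.
  have zown : z \in own (maxn k K') (creator h).
    exact: own_mono (leq_maxr _ _) (last_own lz).
  have hown := own_mono (leq_maxl k K') hk.
  have [/self_anc_anc/round_anc|zh] := own_total hown zown.
    by have := hR _ _ (last_own lz); lia.
  by apply: anc_trans (self_anc_anc ey) (anc_trans yz (self_anc_anc zh)).
(* One round above [R] is for an honest event; the second one gives a promoted event, which has such
   an honest event among its electors. *)
exists R.+2 => z hz rz.
have [z' [z'z rz' _ pz']] := @promoted_ancestor _ _ _ z R.+2 isT rz.
have [a /creatorsP[w + wa] aC] := supermajority_honest hC pz'.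
rewrite mem_electors => /and4P[wz' _ /eqP rw _].
have hw : held w.
  exact: (consistent_anc consistent_held (consistent_anc consistent_held hz z'z) wz').
apply: anc_trans (anc_trans wz' z'z).
by apply: late => //; [rewrite wa|lia].
Qed.

Lemma rounds_unbounded M : exists K, forall q k, K <= k -> q \notin C ->
  exists2 z, last_of (st k) q = Some z & M <= round z.
Proof.
elim: M => [|M [K hK]].
  apply: eventually_fintype => q; have [qC|qC] := boolP (q \in C); first by exists 0.
  have [K [y ly]] := eventually_created qC.
  by exists K => k Kk _; have [z lz _] := last_mono Kk ly; exists z.
(* A single honest event beyond round [M] suffices, as it is received by everyone. Without one, all
   honest last events stay in round [M] from time [K] on. *)
have [[k [p [y [pC ly ry]]]]|small] := pselect (exists k p y, [/\ p \notin C,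
    last_of (st k) p = Some y & M < round y]).
  have [K' hK'] := eventually_received pC ly; exists K' => q k' Kk' qC.
  have [z lz /round_anc h] := hK' q k' Kk' qC; exists z => //; lia.
(* Two complete exchanges refute this: each [v q] is above all [v0], and [z] is above all [v], so
   [round_grows] applies to the witnesses [w] below [v0]. *)
exfalso.
have /choice[v0 hv0] : forall q, exists y, q \notin C ->
    last_of (st K) q = Some y /\ round y = M.
  move=> q; have [qC|qC] := boolP (q \in C).
    have j : 'I_n.-1 by exists 0; lia.
    by exists (Genesis (Body q [::] 0 (sg 0))).
  have [y ly ry] := hK q K (leqnn _) qC; exists y => _; split=> //.
  by apply/eqP; rewrite eqn_leq ry andbT leqNgt; apply/negP => h; apply: small; exists K, q, y.
have /choice[w hw] : forall q, exists w,
    [/\ w \in self_ancestors (v0 q), witness w & round w = round (v0 q)].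
  by move=> q; apply: witness_below.
have received K0 (u : 'I_n -> event) : (forall q, q \notin C -> last_of (st K0) q = Some (u q)) ->
    exists K1, K0 <= K1 /\ forall q k, K1 <= k -> q \notin C ->
      exists2 z, last_of (st k) q = Some z & forall q', q' \notin C -> u q' \in ancestors z.
  move=> hu.
  have [K1 hK1] : exists K1, forall q' k, K1 <= k -> q' \notin C -> forall q, q \notin C ->
      exists2 z, last_of (st k) q = Some z & u q' \in ancestors z.
    apply: eventually_fintype => q'; have [qC|qC] := boolP (q' \in C); first by exists 0.
    have [K1 hK1] := eventually_received qC (hu q' qC).
    by exists K1 => k Kk _ q; apply: hK1.
  exists (maxn K0 K1); split; first exact: leq_maxl.
  move=> q k; rewrite geq_max => /andP[_ Kk] qC.
  have [z lz _] := hK1 q k Kk qC q qC; exists z => // q' q'C.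
  by have [z'] := hK1 q' k Kk q'C q qC; rewrite lz => -[<-].
have [K1 [_ hK1]] := received K v0 (fun q qC => (hv0 q qC).1).
have /choice[v hv] : forall q, exists y, q \notin C ->
    last_of (st K1) q = Some y /\ forall q', q' \notin C -> v0 q' \in ancestors y.
  move=> q; have [qC|qC] := boolP (q \in C); first by exists (v0 q).
  by have [y ly hy] := hK1 q K1 (leqnn _) qC; exists y.
have [K2 [_ hK2]] := received K1 v (fun q qC => (hv q qC).1).
have [q0 _ q0C] := supermajority_honest hC (cardC3 hC).
have [z lz vz] := hK2 q0 K2 (leqnn _) q0C.
have zh : held z := own_held q0C (last_own lz).
have vq q : q \notin C -> creator (v q) = q.
  by move=> qC; apply: own_creator qC (last_own (hv q qC).1).
have wv q q' : q \notin C -> q' \notin C -> w q' \in ancestors (v q).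
  move=> qC q'C; have [wq _ _] := hw q'.
  by apply: anc_trans (self_anc_anc wq) _; apply: (hv q qC).2.
apply: small; exists K2, q0, z; split=> //.
apply: (round_grows hC consistent_held zh (v := v) (w := w)) => //.
  by move=> q qC; rewrite vq // vz.
move=> q qC; have [wq ww rw] := hw q; have [lv0 rv0] := hv0 q qC; split=> //.
- apply: own_creator qC (_ : _ \in own K q).
  by rewrite /own /own_of lv0.
- by rewrite rw.
(* If [z] were one of the [w], it would lie both above and below every [v q'] and hence equal events
   of two creators. *)
- move=> wz; have [q1 q1C q10] := other_honest q0.
  have E q' : q' \notin C -> v q' = z.
    by move=> q'C; apply: anc_antisym; [exact: vz|rewrite -wz; exact: wv].
  by move: q10; rewrite -(vq q1) // -(vq q0) // !E // eqxx.
Qed.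

(** A transaction leaves the buffer only into the next event of [p], and a sync from any other
    honest party makes [p] create one. *)
Lemma buffer_own k p tx : p \notin C -> tx \in buffer (party (st k) p) ->
  exists K e, [/\ e \in own K p & tx \in txs e].
Proof.
move=> pC tk.
have keep K : k <= K -> tx \in buffer (party (st K) p) \/ exists e, e \in own K p /\ tx \in txs e.
  elim: K => [|K IHK]; first by rewrite leqn0 => /eqP <-; left.
  rewrite leq_eqVlt => /orP[/eqP <-|/IHK [tK|[e [eK te]]]]; first by left.
    have [h|[clock h]] := step_event c C (st K) (acts K) p.
      by left; have [_] := h (partner K) (sg K); apply.
    right; case: h => [[_ /(_ (partner K) (sg K)) h]|[sp [op [_ /(_ (partner K) (sg K)) h]]]];
      eexists; split; [exact: (last_own (k := K.+1) h)| |
                       exact: (last_own (k := K.+1) h)|]; exact: tK.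
  by right; exists e; split=> //; apply: own_mono eK.
have [q qC qp] := other_honest p.
have [K0 [y ly]] := eventually_created qC.
have [y' ly' _] := last_mono (leq_maxr k K0) ly.
have [K [kK _ _ [clock [sp [op [_ _ lx]]]]]] := eventually_synced qC pC qp ly'.
have kK' : k <= K by lia.
have [tK|[e [eK te]]] := keep K kK'; last by exists K, e.
by exists K.+1; eexists; split; [exact: last_own lx|].
Qed.

(** * Decision of every election in a lucky run *)

Definition lucky base r : Prop := forall i b,
  (forall K, exists2 k, K <= k & bet c C base r i b (st k) (acts k)) ->
  forall K, exists2 k, K <= k & bet c C base r i b (st k) (acts k) /\ middle_bit (sg k) = b.

Let held_consistent := consistent_held.

Lemma own_witness_uniq k k' q r e e' :
  own_witness C (st k) q r e -> own_witness C (st k') q r e' -> e = e'.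
Proof.
move=> [qC eq we re] [_ eq' we' re'].
have ce := own_creator qC eq; have ce' := own_creator qC eq'.
apply: (honest_witness_uniq hC held_consistent) => //; rewrite ?ce ?ce' ?re //.
  exact: own_held qC eq.
exact: own_held qC eq'.
Qed.

Lemma own_witness_mono k k' q r e : k <= k' ->
  own_witness C (st k) q r e -> own_witness C (st k') q r e.
Proof. by move=> kk [qC eq we re]; split=> //; apply: own_mono kk eq. Qed.

Lemma flipped_mono k k' r : k <= k' -> flipped C (st k) r \subset flipped C (st k') r.
Proof.
move=> kk; apply/fintype.subsetP => q /flippedP[e he]; apply/flippedP; exists e.
exact: own_witness_mono he.
Qed.

Lemma honest_witness r : 0 < r -> exists e, [/\ held e, creator e \notin C, witness e & round e = r].
Proof.
move=> r0; have [K hK] := rounds_unbounded r.+1.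
have [q0 _ q0C] := supermajority_honest hC (cardC3 hC).
have [z lz rz] := hK q0 K (leqnn _) q0C.
have hz : held z := own_held q0C (last_own lz).
have [y [yz ry _ py]] := promoted_ancestor (r0 : 1 < r.+1) rz.
have [a /creatorsP[w + wa] aC] := supermajority_honest hC py.
rewrite mem_electors ry => /and4P[wy ww /eqP[rw] _]; exists w; split=> //; last by rewrite wa.
exact: (consistent_anc held_consistent (consistent_anc held_consistent hz yz) wy).
Qed.


Lemma run_birth k q birth : births c C (st k) (acts k) q birth ->
  [/\ last_of (st k.+1) q = Some (birth (sg k)),
      own_of (st k.+1) q = birth (sg k) :: own_of (st k) q,
      creator (birth (sg k)) = q & coin (birth (sg k)) = middle_bit (sg k)].
Proof.
move=> [qC [clock [sp [op [ls bE /(_ (partner k) (sg k)) lb]]]]].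
split; first exact: lb.
- by rewrite /own_of (_ : last_of (st k.+1) q = Some (birth (sg k))) // ls bE.
- by rewrite bE.
- by rewrite bE.
Qed.

Lemma run_birth_others k q birth p : births c C (st k) (acts k) q birth -> p != q ->
  party (st k.+1) p = party (st k) p.
Proof.
move=> [qC [clock [sp [op [ls bE /(_ (partner k) (sg k)) lb]]]]] pq.
have [p0 hp0] := only_actor_moves c C hn (st k) (acts k).
suff qp0 : q = p0 by apply: hp0; rewrite -qp0.
apply/eqP; apply: contraT => /(hp0 q (partner k) (sg k)) E.
move: lb; rewrite /last_of E -/(last_of _ _) ls bE => -[].
move=> E'.
have /andP[/negP[]] :=
  child_notin_anc (Body q (buffer (party (st k) q)) clock (sg k)) sp op.
by rewrite -E' anc_refl.
Qed.

(** Being a witness, the round and the electors do not depend on the signature, so the bet on [e]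
    can be stated before [e] is signed. Genesis events are excluded by [1 < r]. *)
Lemma witness_born k q r e : 1 < r ->
  own_witness C (st k.+1) q r e -> e \notin own k q ->
  exists birth, births c C (st k) (acts k) q birth /\
    forall s, [/\ witness (birth s), round (birth s) = r & electors (birth s) = electors e].
Proof.
move=> r1 [qC eown we re] nek.
case: (step_event c C (st k) (acts k) q) => [h|[clock [[_ h]|[sp [op [ls h]]]]]].
- have [E _] := h (partner k) (sg k).
  suff : e \in own k q by rewrite (negPf nek).
  by rewrite /own /own_of -E; exact: eown.
- have E : last_of (st k.+1) q = _ := h (partner k) (sg k); move: eown.
  rewrite /own_of E /= inE => /eqP ee.
  by move: r1; rewrite -re ee.
have E : last_of (st k.+1) q = _ := h (partner k) (sg k); move: eown.
rewrite /own_of E mem_self_anc_child => /orP[/eqP ee|esp]; last first.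
  suff : e \in own k q by rewrite (negPf nek).
  by rewrite /own /own_of ls.
exists (fun s => Child (Body q (buffer (party (st k) q)) clock s) sp op); split.
  by split=> //; exists clock, sp, op.
move=> s; split.
- by move: we; rewrite ee /is_true => <-; apply: witness_signature.
- by rewrite -re ee; apply: round_signature.
- by rewrite ee; apply: electors_signature.
Qed.

(* If infinitely many coin rounds start with [i] honest coins that come up as
   desired, then either one of them has no further honest witness and decides the
   election, or infinitely many bets are placed on coin number [i], and infinitely
   many of these are won.  But a round has at most [n] honest witnesses. *)
Lemma election_decided base r : lucky base r ->
  exists d, 0 < d /\ forall y, core C held y -> round y = r + d -> decides_from c base d y.
Proof.
move=> luck; apply: contrapT => undecided.
have [M prom] := eventually_promoted held_consistent held_spread.
have own_core q rho k e : own_witness C (st k) q rho e -> core C held e.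
  move=> [qC eq _ _]; apply: core_honest; first exact: own_held qC eq.
  by rewrite (own_creator qC eq).
(* Contrapositive of [lucky_round]: in an undecided election every late coin round has an honest
   coin against the majority found. *)
have unlucky d b q k y1 : 1 < d -> d %% c = 0 -> M <= r + d ->
    own_witness C (st k) q (r + d) y1 -> (tally_from c base d y1).1 = b ->
    exists z, [/\ held z, creator z \notin C, witness z, round z = r + d & coin z <> b].
  move=> d1 dc Md oy1 ty1; apply: contrapT => nz; apply: undecided.
  have := @lucky_round _ _ _ c C held hC held_consistent hc base r d b y1.
  case=> //.
  - by move=> y cy ry; apply: prom => //; lia.
  - exact: own_core oy1.
  - by case: oy1.
  - by move=> z hz zC wz rz; apply: contrapT => cz; apply: nz; exists z.
  - move=> i hi; exists (d + i); split; first by lia.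
    by move=> y cy ry; apply: hi => //; lia.
(* The bound [B] turns one occurrence into infinitely many. *)
have stage i : forall B, exists b d k, [/\ B < r + d, 1 < d, d %% c = 0,
    #|flipped C (st k) (r + d)| = i & winning c C base (st k) r d b].
  elim: i => [|i IHi].
    (* At time 0 there is no event, so any late coin round and either value will do. *)
    move=> B; exists true, (c * B.+2), 0.
    have nown q rho e : ~ own_witness C (st 0) q rho e by case.
    split; [nia|nia|exact: modnMr| |].
      by apply: eq_card0 => q; apply/negP => /flippedP[e /nown].
    by split=> [q e /nown//|/card_gt0P[q /flippedP[e /nown]]].
  have [b hb] : exists b, forall K, exists2 k, K <= k & bet c C base r i b (st k) (acts k).
    suff : forall K, exists2 k, K <= k &
        bet c C base r i true (st k) (acts k) \/ bet c C base r i false (st k) (acts k).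
      by move=> /infinitely_often_or[]; [exists true|exists false].
    move=> K; have [R hR] := rounds_bounded K.
    have [b [d [k [Bd d1 dc ik wk]]]] := IHi (maxn M R).+1.
    (* A further honest witness is still to come: for [i = 0] because rounds grow, otherwise because
       all [i] coins so far agree while some coin of the round must not. *)
    have [z [hz zC wz rz zk]] : exists z, [/\ held z, creator z \notin C, witness z,
        round z = r + d & z \notin own k (creator z)].
      have [i0|i0] := posnP i.
        have [|z [hz zC wz rz]] := @honest_witness (r + d); first by lia.
        exists z; split=> //; apply/negP => zk; move: ik; rewrite i0.
        move=> /cards0_eq /finset.setP /(_ (creator z)); rewrite [RHS]inE => /flippedP.
        by apply; exists z.
      have [q [y1 [oy1 ty1]]] := wk.2 ltac:(by rewrite ik).
      have [z [hz zC wz rz cz]] := unlucky d b q k y1 d1 dc ltac:(lia) oy1 ty1.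
      by exists z; split=> //; apply/negP => zk; apply: cz; apply: (wk.1 (creator z)).
    set rho := r + d in Bd ik wk rz *.
    have [k2 zk2] := held_own hz zC.
    have oz : own_witness C (st (maxn k k2)) (creator z) rho z.
      by split=> //; apply: own_mono zk2; apply: leq_maxr.
    have changed : exists m, (k <= m) && (flipped C (st m) rho != flipped C (st k) rho).
      exists (maxn k k2); rewrite leq_maxl /=; apply/eqP => E.
      have : creator z \in flipped C (st (maxn k k2)) rho by apply/flippedP; exists z.
      rewrite E => /flippedP[e oe].
      by case/negP: zk; rewrite {1}(own_witness_uniq oz oe); case: oe.
    (* Step [m] is the first after time [k] that adds a coin in round [rho]; until then the
       situation of time [k] persists. *)
    have [[|m] /andP[km Wm] mmin] := ex_minnP changed.
      by move: km Wm; rewrite leqn0 => /eqP->; rewrite eqxx.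
    have km' : k <= m.
      by move: km; rewrite leq_eqVlt => /orP[/eqP E|//]; move: Wm; rewrite E eqxx.
    have {}Wm' : flipped C (st m) rho = flipped C (st k) rho.
      by apply/eqP; apply: contraT => h; have := mmin m; rewrite km' h => /(_ isT); rewrite ltnn.
    have /fintype.subsetPn[q /flippedP[e oe] qm] :
        ~~ (flipped C (st m.+1) rho \subset flipped C (st m) rho).
      apply: contra Wm => sub; rewrite -Wm' finset.eqEsubset sub /=.
      exact: flipped_mono (leqnSn m).
    have em : e \notin own m q.
      by apply: contra qm => em; apply/flippedP; exists e; case: oe.
    have rho1 : 1 < rho by move: Bd; clear; lia.
    have [birth [hb hbirth]] := witness_born rho1 oe em.
    exists m.
      (* Own events of time [K] have rounds at most [R], which is below [rho]. *)
      rewrite leqNgt; apply/negP => mK; have [_ eo _ re] := oe.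
      by have := hR _ _ (own_mono mK eo); rewrite re; lia.
    have old q' e' : own_witness C (st m) q' rho e' ->
        own_witness C (st k) q' rho e'.
      move=> oe'; have : q' \in flipped C (st m) rho by apply/flippedP; exists e'.
      by rewrite Wm' => /flippedP[e'' oe'']; rewrite (own_witness_uniq oe' oe'').
    suff : exists b', bet c C base r i b' (st m) (acts m) by case=> -[]; [left|right].
    (* The first honest witness sets the target by its own tally; later ones inherit it. *)
    exists (if i == 0 then (tally_from c base d e).1 else b), q, birth, d; split.
      by split=> // s; have [] := hbirth s.
    split; first by rewrite Wm'.
      split=> [q' e' /old oe'|]; rewrite -/rho ?Wm' ?ik.
        have /card_gt0P : exists q, q \in flipped C (st k) rho.
          by exists q'; apply/flippedP; exists e'.
        by rewrite ik; case: posnP => // _ _; apply: wk.1 oe'.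
      move=> i0; rewrite -ik in i0; have [q' [e' [oe' te']]] := wk.2 i0.
      exists q', e'; split; first exact: own_witness_mono oe'.
      by rewrite te' -ik; case: posnP i0.
    by move=> -> s /=; rewrite /tally_from; have [_ _ ->] := hbirth s.
  have wins := luck i b hb => B.
  (* By time [K] honest last events are beyond round [B], so a witness born later is as well. *)
  have [K hK] := rounds_unbounded B.+1.
  have [k Kk [[q [birth [d [[hb1 d1 dc hbirth] [ik wk ti]]]]] mb]] := wins K.
  have [ls ow cr co] := run_birth hb1; have [wy ry] := hbirth (sg k).
  set y := birth (sg k) in ls ow cr co wy ry.
  have qC : q \notin C by case: hb1.
  have oy : own_witness C (st k.+1) q (r + d) y by split=> //; rewrite ow inE eqxx.
  have Bd : B < r + d.
    have [z] := hK q k.+1 (leqW Kk) qC; rewrite ls => -[<-].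
    by rewrite ry.
  have fresh e : own_witness C (st k) q (r + d) e -> False.
    move=> oe; have := own_witness_uniq (own_witness_mono (leqnSn k) oe) oy => E.
    case: oe; rewrite E => _ yo _ _; case: hb1 => _ [clock [sp [op [lsp bE _]]]].
    move: yo; rewrite /own_of lsp /y bE => /self_anc_anc h.
    by have /andP[/negP[]] := child_notin_anc (Body q (buffer (party (st k) q)) clock (sg k)) sp op.
  have split_own p e : own_witness C (st k.+1) p (r + d) e ->
      p = q /\ e = y \/ own_witness C (st k) p (r + d) e.
    have [->|pq] := eqVneq p q.
      by move=> oe; left; split=> //; apply: own_witness_uniq oe oy.
    move=> [pC eo we re]; right; split=> //.
    by move: eo; rewrite /own_of /last_of (run_birth_others hb1 pq).
  exists b, d, k.+1; split=> //.
    rewrite (_ : flipped C (st k.+1) (r + d) = q |: flipped C (st k) (r + d)).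
      rewrite cardsU1 ik (_ : q \notin _) ?add1n //.
      by apply/flippedP => -[e /fresh].
    apply/finset.setP => p; rewrite finset.in_setU1; apply/idP/idP.
      move=> /flippedP[e /split_own[[-> _]|oe]]; first by rewrite eqxx.
      by apply/orP; right; apply/flippedP; exists e.
    move=> /orP[/eqP ->|]; first by apply/flippedP; exists y.
    by apply/fintype.subsetP/flipped_mono.
  split=> [p e /split_own[[_ ->]|]|_]; [by rewrite co| exact: wk.1|].
  have [i0|i0] := posnP i; first by exists q, y; split=> //; apply: ti.
  have [q' [e' [oe' te']]] := wk.2 ltac:(by rewrite ik).
  by exists q', e'; split=> //; apply: own_witness_mono oe'.
have [b [d [k [_ _ _ full _]]]] := stage n.+1 0.
by have := max_card (mem (flipped C (st k) (r + d))); rewrite full card_ord ltnn.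
Qed.

(** * From decided elections to the log *)

Lemma fame_decided (H : seq event) x y : y \in H -> witness y -> round x < round y ->
  decides c x y -> isSome (fame c H x).
Proof.
move=> yH wy xy dxy; rewrite /fame.
set voters := sort _ _; have : y \in [seq y <- voters | decides c x y].
  by rewrite mem_filter dxy mem_sort mem_filter wy xy.
by case: [seq y <- voters | decides c x y].
Qed.

Lemma eventually_held M q : q \notin C -> exists K z, [/\ z \in graph_of (st K) q,
  core C held z, M <= round z & forall y, y \in ancestors z -> y \in graph_of (st K) q].
Proof.
move=> qC; have [K hK] := rounds_unbounded M; have [z lz rz] := hK q K (leqnn _) qC.
have [loc _ _] := invariant_run K; have [_ clos own] := loc q qC.
have [zq zg] := own z lz; exists K, z; split=> //; last by move=> y; apply: clos zg.
by apply: core_honest; [exact: own_held qC (last_own lz)|rewrite zq].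
Qed.

Definition lucky_run : Prop :=
  (forall k q x, x \in graph_of (st k) q -> lucky (fun y => sees y x) (round x)) /\
  forall r, lucky xpred0 r.

(** The candidates that [q] holds at time [K0] are finitely many, and each has its own deciding
    round. A later one is not below [z0], so the votes on it below [z0] are those of the fictitious
    election of its round, and [z0] is high enough to have a deciding witness of that below it. *)
Lemma eventually_fame q r : q \notin C -> lucky_run ->
  exists K, forall k x, K <= k -> x \in graph_of (st k) q -> round x <= r ->
    isSome (fame c (graph_of (st k) q) x).
Proof.
move=> qC [luck luck0].
have /choice[d0 hd0] := fun r' => election_decided (luck0 r').
pose R0 := \max_(r' < r.+1) (r' + d0 r').
have [K0 [z0 [zg0 cz0 rz0 clos0]]] := eventually_held R0 qC.
have /choice[d hd] : forall x, exists d, x \in graph_of (st K0) q -> 0 < d /\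
    forall y, core C held y -> round y = round x + d -> decides_from c (fun y => sees y x) d y.
  move=> x; have [xg|_] := boolP (x \in graph_of (st K0) q); last by exists 0.
  by have [d hd] := election_decided (luck _ _ _ xg); exists d.
pose R := \max_(x <- graph_of (st K0) q) (round x + d x).
have [K1 [z1 [zg1 cz1 rz1 clos1]]] := eventually_held R qC.
exists (maxn K0 K1) => k x; rewrite geq_max => /andP[K0k K1k] xk xr.
have decided K z dx : K <= k -> core C held z -> round x + dx <= round z -> 0 < dx ->
    (forall y, y \in ancestors z -> y \in graph_of (st K) q) ->
    (forall y, y \in ancestors z -> core C held y -> round y = round x + dx ->
       decides_from c (fun y => sees y x) dx y) ->
    isSome (fame c (graph_of (st k) q) x).
  move=> Kk cz rz dx0 clos dec.
  have [|y [yz ry wy _]] := @promoted_ancestor _ _ _ z (round x + dx) _ rz.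
    by have := round_gt0 x; lia.
  apply: (@fame_decided _ _ y) => //; first exact: graph_mono Kk (clos y yz).
    by rewrite ry; lia.
  rewrite decides_fromE ry addKn; apply: dec => //; exact: core_anc cz yz.
have [xg|xg] := boolP (x \in graph_of (st K0) q).
  have [dx0 decx] := hd x xg; apply: (decided K1 z1 (d x)) => //.
    by apply: leq_trans rz1; apply: (leq_bigmax_seq _ xg).
  by move=> y _; apply: decx.
have [dx0 decx] := hd0 (round x); apply: (decided K0 z0 (d0 (round x))) => //.
  apply: leq_trans rz0; rewrite /R0.
  by rewrite (bigmax_sup (Ordinal (xr : round x < r.+1))).
move=> y yz cy ry; rewrite decides_from_late; first exact: decx.
by apply: contra xg => xy; apply: clos0; apply: anc_trans yz.
Qed.

Lemma liveness p tx k q : p \notin C -> q \notin C -> lucky_run ->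
  tx \in buffer (party (st k) p) -> exists K, tx \in tx_log (party (st K) q).
Proof.
move=> pC qC luck tk; have [k0 [e [eo te]]] := buffer_own pC tk.
have he := own_held pC eo; have ep := own_creator pC eo.
have eC : creator e \notin C by rewrite ep.
(* [round_received] searches from round 1, hence the [maxn]. *)
have [M hM] := held_spread he eC; pose r := maxn M 1.
have [K0 hK0] := eventually_fame r qC luck.
have [K1 [z [zg cz rz clos]]] := eventually_held r qC.
(* [q] orders events only upon a delivery; one more honest sync after [K0] and [K1] provides it. *)
have [q' q'C qq'] := other_honest q.
have [K2 [y ly]] := eventually_created q'C.
have [y' ly' _] := last_mono (leq_maxr (maxn K0 K1) K2) ly.
have [K [+ ordered _ _]] := eventually_synced q'C qC qq' ly'.
rewrite !geq_max => /andP[/andP[K0K K1K] _].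
set H := graph_of (st K.+1) q in ordered.
have zH : z \in H by apply: graph_mono zg; apply: leqW.
have zh : held z by exists K1, q.
have eH : e \in H.
  apply: graph_mono (leqW K1K) (clos _ _).
  by apply: hM => //; move: rz; rewrite geq_max => /andP[].
have receivedP : isSome (round_received c H e).
  rewrite /round_received; set rounds := [seq _ <- _ | _].
  (* An earlier round may be the one assigned; one admissible round is enough. *)
  suff : r \in rounds by case: rounds.
  rewrite mem_filter mem_iota; apply/andP; split; last first.
    rewrite /r leq_maxr /= add1n ltnS.
    by apply: leq_trans rz _; apply: (leq_bigmax_seq _ zH).
  apply/andP; split; apply/allP => w.
    rewrite mem_filter => /andP[/andP[/and4P[_ _ /eqP rw _] _] wH].
    have hw : held w by exists K.+1, q.
    by apply: (sees_honest held_consistent hw) => //; apply: hM; rewrite // rw leq_maxl.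
  by move=> wH; apply/implyP => /andP[_ wr]; apply: hK0 => //; apply: leqW.
exists K.+1; rewrite /tx_log; apply/flattenP; exists (txs e) => //.
apply: map_f; rewrite ordered mem_cat.
by case ec: (e \in _) => //=; rewrite mem_sort mem_filter ec eH receivedP.
Qed.

End Execution.

(** * Almost sure wins *)

Section Fresh.
Import Order.TTheory GRing.Theory Num.Theory numFieldNormedType.Exports.
Local Open Scope classical_set_scope.
Local Open Scope ring_scope.
Local Open Scope ereal_scope.

Lemma ae_forall_countable (d : measure_display) (T : measurableType d) (R : realType)
    (mu : {measure set T -> \bar R}) (I : countType) (Q : I -> T -> Prop) :
  (forall i, {ae mu, forall x, Q i x}) -> {ae mu, forall x, forall i, Q i x}.
Proof.
move=> h; pose Q' m x := if unpickle m is Some i then Q i x else True.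
have : {ae mu, forall x, forall m, Q' m x}.
  apply: ae_foralln => m; rewrite /Q'; case: (unpickle m) => [i|]; first exact: h.
  exact: nearW.
by apply: filterS => x hx i; have := hx (pickle i); rewrite /Q' pickleK.
Qed.

Context (Tx : eqType) (n ell : nat).
Context (d : measure_display) (Omega : measurableType d) (R : realType).
Context (P : probability Omega R).
Context (acts : nat -> Omega -> action Tx n ell).
Context (partner : nat -> Omega -> 'I_n.-1).
Context (sg : nat -> Omega -> ell.-tuple bool).
Context (fresh : fresh_randomness P acts partner sg).
Local Notation past := (past acts partner sg).
Implicit Types (w : Omega) (k : nat) (A : nat -> Omega -> Prop) (S : set Omega).

Lemma past_eqP k w w' : past k w = past k w' <->
  (forall i, (i <= k)%N -> acts i w = acts i w') /\
  (forall i, (i < k)%N -> partner i w = partner i w' /\ sg i w = sg i w').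
Proof.
split=> [E|[ha hs]]; last first.
  congr pair; apply/eq_in_map => i; rewrite mem_iota /= add0n => ik; first exact: ha.
  by have [-> ->] := hs i ik.
split=> i ik.
  by have := congr1 (fun h => nth (acts i w) h.1 i) E; rewrite /= !nth_mkseq.
have := congr1 (fun h => nth (partner i w, sg i w) h.2 i) E.
by rewrite /= !nth_mkseq // => -[-> ->].
Qed.

Lemma past_le k k' w w' : (k <= k')%N -> past k' w = past k' w' -> past k w = past k w'.
Proof.
move=> kk /past_eqP[ha hs]; apply/past_eqP; split=> i ik; first by apply: ha; lia.
by apply: hs; lia.
Qed.

(** Predictability at step [k]. All such sets are measurable by [fresh_randomness], so no
    measurability of the protocol itself has to be proved. *)
Definition determined k S : Prop := forall w w', past k w = past k w' -> S w -> S w'.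

Lemma determinedE k S : determined k S ->
  S = [set w | exists2 w0, past k w0 = past k w & S w0].
Proof.
move=> hS; apply/seteqP; split=> [w Sw|w [w0 E S0]]; first by exists w.
exact: hS E S0.
Qed.

Lemma determined_measurable k S : determined k S -> measurable S.
Proof.
(* [fresh_randomness] has to be given a partner, and a point of [Omega] supplies one. *)
move=> hS; rewrite (determinedE hS); have [w0|noOmega] := pselect (exists w : Omega, True).
  case: w0 => w0 _.
  exact: (fresh k (fun h => exists2 w0, past k w0 = h & S w0) (partner 0 w0) true).1.
rewrite (_ : [set w | _] = set0) //; apply/seteqP; split=> // w _.
by case: noOmega; exists w.
Qed.

Definition outcome k (j : 'I_n.-1) (b : bool) : set Omega :=
  [set w | partner k w = j /\ middle_bit (sg k w) = b].

Definition delta : R := ((2 * n.-1)%:R^-1)%R.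

Lemma outcome_prob k S j b : determined k S -> P (S `&` outcome k j b) = delta%:E * P S.
Proof.
move=> hS; have := (fresh k (fun h => exists2 w0, past k w0 = h & S w0) j b).2.
rewrite -(determinedE hS) => <-; congr (P _).
apply/seteqP; split=> w.
  by case=> Sw [h1 h2]; split=> //; exists w.
by case=> -[w0 E S0] h1 h2; split=> //; apply: hS E S0.
Qed.

Lemma outcome_determined k j b : determined k.+1 (outcome k j b).
Proof. by move=> w w' /past_eqP[_ /(_ k (ltnSn k))[E1 E2]] [<- <-]; rewrite E1 E2. Qed.

Section Bet.
Context (A : nat -> Omega -> Prop) (hA : forall k, determined k (A k)).
Context (j : 'I_n.-1) (b : bool) (K : nat).

Fixpoint bets k w : nat :=
  if k is i.+1 then (bets i w + ((K <= i) && `[<A i w>]))%N else 0.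

Definition losing k w : Prop := forall i, (K <= i < k)%N -> A i w -> ~ outcome i j b w.

(* Bets are counted from 0. *)
Definition nth_bet m k : set Omega :=
  [set w | [/\ (K <= k)%N, A k w, bets k w = m & losing k w]].

Lemma nth_bet_determined m k : determined k (nth_bet m k).
Proof.
move=> w w' E [Kk Ak bk lk].
have EA i : (i <= k)%N -> A i w <-> A i w'.
  by move=> ik; split; apply: hA; [|apply/esym]; apply: past_le E.
split=> //; first exact/EA.
  rewrite -bk; have {bk lk Kk Ak E} : (k <= k)%N by [].
  elim: {1 3 4}k => [|i IHi] //= ik; rewrite IHi; last by lia.
  by congr (_ + (_ && _))%N; apply: asbool_equiv_eq; rewrite EA //; lia.
move=> i /andP[Ki ik] /EA Ai h; apply: (lk i); rewrite ?Ki ?ik //; first by apply: Ai; lia.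
have Ei : past i.+1 w' = past i.+1 w by apply/esym; apply: past_le E.
exact: outcome_determined Ei h.
Qed.

Lemma bets_leq k k' w : (k <= k')%N -> (bets k w <= bets k' w)%N.
Proof.
elim: k' => [|k' IH]; first by rewrite leqn0 => /eqP->.
by rewrite leq_eqVlt => /orP[/eqP->//|/IH h] /=; lia.
Qed.

Lemma bets_lt k k' w : (K <= k)%N -> A k w -> (k < k')%N -> (bets k w < bets k' w)%N.
Proof.
move=> Kk Ak kk; apply: leq_trans (bets_leq w kk).
by rewrite /= Kk asboolT //=; lia.
Qed.

Lemma nth_bet_trivIset m : trivIset setT (nth_bet m).
Proof.
apply/trivIsetP => k k' _ _ kk'; apply/seteqP; split=> // w [[Kk Ak bk _] [Kk' Ak' bk' _]].
move: kk'; rewrite neq_ltn => /orP[] /bets_lt; first by move=> /(_ _ Kk Ak); lia.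
by move=> /(_ _ Kk' Ak'); lia.
Qed.

Lemma nth_bet_pred m k w : nth_bet m.+1 k w ->
  exists k', (nth_bet m k' `\` outcome k' j b) w.
Proof.
move=> [_ _ bk lk].
have : (0 < bets k w)%N by lia.
elim: k m bk lk => [|k IHk] m //= bk lk _.
have lk' : losing k w by move=> i /andP[Ki ik]; apply: lk; rewrite Ki /=; lia.
have [/andP[Kk /asboolP Ak]|/negPf nA] := boolP ((K <= k)%N && `[<A k w>]).
  exists k; split; last by apply: lk; rewrite ?Kk /=.
  by split=> //; move: bk; rewrite Kk asboolT //=; lia.
by apply: IHk => //; move: bk; rewrite nA; lia.
Qed.

(** The sets [nth_bet m k] are disjoint in [k] and predictable, so exactly the fraction [1 - delta]
    of their union loses bet [m]; only there can bet [m.+1] be placed. *)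
Lemma nth_bet_prob m : P (\bigcup_k nth_bet m k) <= ((1 - delta) ^+ m)%:E.
Proof.
have d01 : (0 <= 1 - delta :> R)%R.
  (* For [n <= 1] the inverse of 0 is 0. *)
  rewrite subr_ge0 /delta; case: (2 * n.-1)%N => [|k]; first by rewrite invr0.
  by rewrite invf_le1 ?ltr0n // ler1n.
elim: m => [|m IHm].
  rewrite expr0 probability_le1 //; apply: bigcup_measurable => k _.
  exact: determined_measurable (@nth_bet_determined 0 k).
have mG k : measurable (nth_bet m k) := determined_measurable (@nth_bet_determined m k).
have mO k : measurable (outcome k j b) := determined_measurable (@outcome_determined k j b).
have lose k : P (nth_bet m k `\` outcome k j b) = (1 - delta)%:E * P (nth_bet m k).
  transitivity (P (nth_bet m k) - P (nth_bet m k `&` outcome k j b)).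
    by apply: measureD => //; rewrite (le_lt_trans (probability_le1 _ _)) ?ltry.
  rewrite (outcome_prob j b (@nth_bet_determined m k)).
  rewrite -[P (nth_bet m k)]fineK ?fin_num_measure //.
  by rewrite -!EFinM -EFinB mulrBl mul1r.
have -> : (((1 - delta) ^+ m.+1)%:E = (1 - delta)%:E * ((1 - delta) ^+ m)%:E :> \bar R).
  by rewrite exprS EFinM.
apply: (@le_trans _ _ (P (\bigcup_k (nth_bet m k `\` outcome k j b)))).
  apply: le_measure; rewrite ?inE.
  - by apply: bigcup_measurable => k _; apply: determined_measurable (@nth_bet_determined _ k).
  - by apply: bigcup_measurable => k _; apply: measurableD.
  - by move=> w [k _ /nth_bet_pred[k' hk']]; exists k'.
have sumE (F : nat -> set Omega) : (forall k, measurable (F k)) -> trivIset setT F ->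
    P (\bigcup_k F k) = \sum_(k <oo) P (F k).
  by move=> mF tF; apply: measure_semi_bigcup => //; apply: bigcup_measurable.
rewrite sumE; [|by move=> k; apply: measurableD|].
  under eq_eseriesr do rewrite lose.
  rewrite nneseriesZl // -sumE //; last exact: nth_bet_trivIset.
  by apply: lee_wpmul2l IHm; rewrite ?lee_fin.
by apply: trivIset_setIr; apply: nth_bet_trivIset.
Qed.

Lemma nth_bet_exists m w : (forall K', exists2 k, (K' <= k)%N & A k w) ->
  (forall k, (K <= k)%N -> A k w -> ~ outcome k j b w) -> exists k, nth_bet m k w.
Proof.
move=> io lost; pose later i k := (i <= k)%N && `[<A k w>].
have next i : exists k, [/\ (i <= k)%N, A k w & forall k', (i <= k' < k)%N -> ~ A k' w].
  have [|k /andP[ik /asboolP Ak] kmin] := @ex_minnP (later i).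
    by have [k ik Ak] := io i; exists k; rewrite /later ik; apply/asboolP.
  exists k; split=> // k' /andP[ik' k'k] Ak'.
  by have := kmin k'; rewrite /later ik' asboolT // => /(_ isT); lia.
have skip i k : (i <= k)%N -> (forall k', (i <= k' < k)%N -> ~ A k' w) ->
    bets k w = bets i w.
  elim: k => [|k IHk]; first by rewrite leqn0 => /eqP->.
  rewrite leq_eqVlt => /orP[/eqP->//|ik] nA /=.
  rewrite IHk ?asboolF ?andbF ?addn0 //; first by apply: nA; rewrite -ltnS ik /=.
  by move=> k' /andP[h1 h2]; apply: nA; rewrite h1 /= ltnW.
have losingk k : losing k w by move=> i /andP[Ki _]; apply: lost.
elim: m => [|m [k [Kk Ak bk _]]].
  have [k [Kk Ak nA]] := next K; exists k; split=> //.
  rewrite (skip K k Kk nA); have {Kk} : (K <= K)%N by [].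
  elim: {1 3}K => [|i IHi] //= iK; rewrite IHi; last by lia.
  by rewrite (_ : (K <= i)%N = false) //; lia.
have [k' [kk' Ak' nA]] := next k.+1; exists k'; split=> //; first by lia.
by rewrite (skip k.+1 k' kk' nA) /= bk Kk asboolT //= addn1.
Qed.

(** A failing run loses infinitely many bets from [K] on, so it places bet number [m] for every [m];
    the bounds [(1 - delta) ^+ m] tend to 0 because [1 < n] makes [delta] positive. *)
Lemma ae_won : (1 < n)%N -> {ae P, forall w,
  (forall K', exists2 k, (K' <= k)%N & A k w) ->
  exists2 k, (K <= k)%N & A k w /\ outcome k j b w}.
Proof.
move=> hn; exists (\bigcap_m \bigcup_k nth_bet m k).
have mB m : measurable (\bigcup_k nth_bet m k).
  by apply: bigcup_measurable => k _; apply: determined_measurable (@nth_bet_determined m k).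
have mN : measurable (\bigcap_m \bigcup_k nth_bet m k) by apply: bigcapT_measurable.
split=> //.
- have PN m : P (\bigcap_m \bigcup_k nth_bet m k) <= ((1 - delta) ^+ m)%:E.
    apply: le_trans (nth_bet_prob m); apply: le_measure; rewrite ?inE //.
    by move=> w; apply.
  apply/eqP; rewrite eq_le measure_ge0 andbT.
  rewrite -[P _]fineK ?fin_num_measure // lee_fin.
  have cv : ((fun m => (1 - delta) ^+ m : R) @ \oo --> (0 : R))%R.
    apply: cvg_expr; rewrite /delta.
    have d0 : (0 < (2 * n.-1)%:R^-1 :> R)%R by rewrite invr_gt0 ltr0n; lia.
    have d1 : ((2 * n.-1)%:R^-1 <= 1 :> R)%R by rewrite invf_le1 ?ler1n ?ltr0n; lia.
    by rewrite ger0_norm ?subr_ge0 // ltrBlDr ltrDl.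
  rewrite -(cvg_lim _ cv) //; apply: limr_ge; first by apply/cvg_ex; exists 0%R.
  by apply: nearW => m; rewrite -lee_fin fineK ?fin_num_measure.
- move=> w /= nw m _; have [k hk] : exists k, nth_bet m k w; last by exists k.
  have [io|nio] := pselect (forall K', exists2 k, (K' <= k)%N & A k w); last by case: nw.
  apply: nth_bet_exists => // k Kk Ak ok; apply: nw => _; by exists k.
Qed.

End Bet.

Lemma ae_infinitely_often_won A j b : (1 < n)%N -> (forall k, determined k (A k)) ->
  {ae P, forall w, (forall K, exists2 k, (K <= k)%N & A k w) ->
    forall K, exists2 k, (K <= k)%N & A k w /\ outcome k j b w}.
Proof.
move=> hn hA; have := ae_foralln (fun K => ae_won hA j b K hn).
by apply: filterS => w h io K; apply: h.
Qed.

End Fresh.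

(** * Almost every execution is lucky *)

Section AlmostSurely.
Local Open Scope ring_scope.
Local Open Scope ereal_scope.
Local Open Scope nat_scope.
Context (Tx : eqType) (n ell c : nat) (C : {set 'I_n}) (hn : 1 < n).
Context (d : measure_display) (Omega : measurableType d) (R : realType).
Context (P : probability Omega R).
Context (acts : nat -> Omega -> action Tx n ell).
Context (partner : nat -> Omega -> 'I_n.-1).
Context (sg : nat -> Omega -> ell.-tuple bool).
Context (fresh : fresh_randomness P acts partner sg).
Local Notation past := (past acts partner sg).
Local Notation st w := (run c C (acts ^~ w) (partner ^~ w) (sg ^~ w)).
Implicit Types (w : Omega) (k K : nat).

Lemma run_past k w w' : past k w = past k w' -> st w k = st w' k.
Proof.
move=> /past_eqP[ha hs]; have : k <= k by [].
elim: {1 3 4}k => [|i IHi] //= ik; have [-> ->] := hs i ik.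
by rewrite ha ?IHi // ltnW.
Qed.

Lemma ae_partners : {ae P, forall w, forall p : 'I_n * 'I_n.-1,
  (forall K, exists2 k, K <= k & exists clock, acts k w = Wake Tx ell p.1 clock) ->
  forall K, exists2 k, K <= k &
    (exists clock, acts k w = Wake Tx ell p.1 clock) /\ partner k w = p.2}.
Proof.
apply: ae_forall_countable => -[p j].
have det k : determined acts partner sg k (fun w => exists clock, acts k w = Wake Tx ell p clock).
  by move=> w w' /past_eqP[/(_ k (leqnn k)) <-].
(* Only the partner matters here; the coin value [true] is arbitrary. *)
have := ae_infinitely_often_won fresh j true hn det.
apply: filterS => w h io K; have [k Kk [? [? _]]] := h io K.
by exists k.
Qed.

(** An election may depend on the run, as long as it is known by time [k0]: bets from then on are
    predictable, and dropping the earlier ones does not affect what happens infinitely often. *)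
Lemma ae_lucky k0 (election : Omega -> (event Tx n ell -> bool) * nat) :
  (forall w w', past k0 w = past k0 w' -> election w = election w') ->
  {ae P, forall w,
    lucky c C (acts ^~ w) (partner ^~ w) (sg ^~ w) (election w).1 (election w).2}.
Proof.
move=> hel; have j0 : 'I_n.-1 by exists 0; lia.
have : {ae P, forall w, forall ib : nat * bool,
  let bets_on k :=
    k0 <= k /\ bet c C (election w).1 (election w).2 ib.1 ib.2 (st w k) (acts k w) in
  (forall K, exists2 k, K <= k & bets_on k) ->
  forall K, exists2 k, K <= k & bets_on k /\ middle_bit (sg k w) = ib.2}.
  apply: ae_forall_countable => -[i b].
  have det k : determined acts partner sg k (fun w => k0 <= k /\
      bet c C (election w).1 (election w).2 i b (st w k) (acts k w)).
    move=> w w' E [k0k]; rewrite (run_past E).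
    have [/(_ k (leqnn k)) -> _] := (past_eqP _ _ _ _ _ _).1 E.
    by rewrite (hel w w') //; apply: past_le E.
  have := ae_infinitely_often_won fresh j0 b hn det.
  by apply: filterS => w h bets_on io K; have [k Kk [? [_ ?]]] := h io K; exists k.
apply: filterS => w h i b io K.
have [|k Kk [[_ hb] mb]] := h (i, b) _ K; last by exists k.
move=> K'; have [k] := io (maxn k0 K'); rewrite geq_max => /andP[k0k K'k] hb.
by exists k.
Qed.

Lemma ae_lucky_run :
  {ae P, forall w, lucky_run c C (acts ^~ w) (partner ^~ w) (sg ^~ w)}.
Proof.
have real : {ae P, forall w, forall kqi : nat * 'I_n * nat, forall x,
    onth (graph_of (st w kqi.1.1) kqi.1.2) kqi.2 = Some x ->
    lucky c C (acts ^~ w) (partner ^~ w) (sg ^~ w) (fun y => sees y x) (round x)}.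
  apply: ae_forall_countable => -[[k q] i] /=.
  (* Positions beyond the end of the hashgraph get an arbitrary election. *)
  have := @ae_lucky k (fun w => if onth (graph_of (st w k) q) i is Some x
    then (fun y => sees y x, round x) else (xpred0, 0)).
  case=> [w w' E|]; first by rewrite (run_past E).
  move=> N [mN N0 sN]; exists N; split=> // w hw; apply: sN => h; apply: hw => x ox.
  by move: h; rewrite /= ox.
have late : {ae P, forall w, forall r,
    lucky c C (acts ^~ w) (partner ^~ w) (sg ^~ w) xpred0 r}.
  apply: ae_foralln => r.
  exact: (@ae_lucky 0 (fun=> (xpred0, r))).
apply: filterS2 real late => w real late; split=> // k q x /onthP[i ox].
exact: (real (k, q, i)) ox.
Qed.

End AlmostSurely.

Theorem theorem8 (R : realType) (d : measure_display)
    (Omega : measurableType d) (P : probability Omega R)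
    (Tx : eqType) (n t c ell : nat) (C : {set 'I_n})
    (acts : nat -> Omega -> action Tx n ell)
    (partner : nat -> Omega -> 'I_n.-1)
    (sg : nat -> Omega -> ell.-tuple bool)
    (hn : 1 < n) (ht : 3 * t < n) (hC : #|C| <= t) (hc : 1 < c)
    (hfresh : fresh_randomness P acts partner sg) :
  {ae P, forall w : Omega,
    fair c C (acts ^~ w) (partner ^~ w) (sg ^~ w) ->
    forall (p : 'I_n) (tx : Tx) (k : nat),
      p \notin C ->
      tx \in buffer (party (run c C (acts ^~ w) (partner ^~ w) (sg ^~ w) k) p) ->
      forall q : 'I_n, q \notin C ->
        exists k' : nat,
          tx \in tx_log (party (run c C (acts ^~ w) (partner ^~ w) (sg ^~ w) k') q)}.
Proof.
have hC3 : 3 * #|C| < n by lia.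
apply: filterS2 (ae_partners hn hfresh) (ae_lucky_run c C hn hfresh).
move=> w partners luck [wake deliver] p tx k pC tk q qC.
apply: (liveness hn hC3 hc _ deliver pC qC luck tk) => p' j K p'C.
have [K'|k' Kk [[clock ak] pk]] := partners (p', j) _ K; last by exists k', clock.
by have [k' [clock [? ?]]] := wake p' K' p'C; exists k' => //; exists clock.
Qed.
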